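(* Let $V$ be a vector space of dimension $N$ over a field $\Bbbk$ with $\mathrm{char}(\Bbbk)\neq2$, equipped with an orthogonal form (a non-degenerate symmetric bilinear form), let $r\ge1$, and let $A^{\mathrm o}_r(\Bbbk)$ be the image of Brauer's homomorphism $\Psi_{r,\Bbbk}:B_r(\Bbbk;N)\to\mathrm{End}(V^{\otimes r})$ defined using the orthogonal form. The Brauer centralizer algebra $A^{\mathrm o}_r(\Bbbk)$ acting on $V^{\otimes r}$ is the specialization of the integral Brauer centralizer algebra $A^{\mathrm o}_r(\mathbb Z)$, i.e. $A^{\mathrm o}_r(\Bbbk)\cong A^{\mathrm o}_r(\mathbb Z)\otimes_{\mathbb Z}\Bbbk$. Consequently, the isomorphism type of $A^{\mathrm o}_r(\Bbbk)$ is independent of the choice of the orthogonal form on $V$.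
   Context: For a commutative ring $U$ and $\delta\in U$, the Brauer algebra $B_r(U;\delta)$ is the free $U$-module on $r$-strand Brauer diagrams (perfect matchings of $r$ top and $r$ bottom vertices), with product $ab=\delta^jc$, where stacking $a$ over $b$ gives the diagram $c$ and $j$ closed loops. It is generated by $s_i$ (the transposition diagram exchanging $i,i+1$) and $e_i$ (joining top vertices $i,i+1$ and bottom vertices $i,i+1$, other strands vertical), $1\le i\le r-1$. For an $N$-dimensional space $V$ over a field with orthogonal form $(\ ,\ )$, put $\omega=\sum_iv_i^*\otimes v_i$ where $(v_i,v_j^* )=\delta_{ij}$ are dual bases. Endomorphisms act on the right. Let $(x\otimes y)E=(x,y)\omega$ and $(x\otimes y)S=y\otimes x$ on $V\otimes V$, and let $E_i,S_i$ be $E,S$ acting in tensor places $i,i+1$ of $V^{\otimes r}$. Brauer's homomorphism $\Psi_r:B_r(\Bbbk;N)\to\mathrm{End}(V^{\otimes r})$ is determined by $e_i\mapsto E_i$, $s_i\mapsto S_i$. The integral Brauer centralizer algebra $A^{\mathrm o}_r(\mathbb Z)$ is the image of $B_r(\mathbb Z;N)\subset B_r(\mathbb C;N)$ under $\Psi_{r,\mathbb C}$ for $V=\mathbb C^N$ with the standard orthogonal form $(x,y)=\sum_ix_iy_{N+1-i}$; equivalently the $\mathbb Z$-subalgebra of $\mathrm{End}((\mathbb C^N)^{\otimes r})$ generated by the $E_i$ and $S_i$. *)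

(* Defs.v *)
From HB Require Import structures.
From mathcomp Require Import all_boot all_order all_algebra perm zify.
From mathcomp Require Import boolp.

Set Implicit Arguments.
Unset Strict Implicit.
Unset Printing Implicit Defensive.

Import GRing.Theory.
Local Open Scope ring_scope.

(* Two involutions without common fixed points generate a graph whose components
   are cycles and paths; the ends of the paths are the fixed points.  Hence a
   component containing one fixed point contains exactly one other. *)
Section Involutions.
Variables (W : finType) (al be : W -> W).

Definition stack_rel : rel W := [rel u v | (v == al u) || (v == be u)].

Definition reach : rel W := connect stack_rel.

Hypotheses (alK : involutive al) (beK : involutive be).
Hypothesis nofix : forall u, al u = u -> be u <> u.

Let pi u := be (al u).

Lemma reach_sym : symmetric reach.
Proof.
apply: sym_connect_sym => u v /=.
by congr orb; rewrite eq_sym ?(inv_eq alK) ?(inv_eq beK).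
Qed.

Let pi_inj : injective pi.
Proof. exact: inj_comp (inv_inj beK) (inv_inj alK). Qed.

Let iter_pi_inj n : injective (iter n pi).
Proof. by elim: n => [|n IH] u v //= /pi_inj /IH. Qed.

Let iter_pi_al n u : iter n pi (al (iter n pi u)) = al u.
Proof. by elim: n u => //= n IH u; rewrite -iterS iterSr /pi !alK beK IH. Qed.

Let iter_pi_be n u : iter n pi (be (iter n pi u)) = be u.
Proof.
elim: n u => //= n IH u; rewrite -iterS iterSr /pi beK alK IH //.
Qed.

Lemma reach_partner x : be x = x ->
  exists y, [/\ y != x, reach x y, al y = y \/ be y = y
    & forall z, reach x z -> z != x -> al z = z \/ be z = z -> z = y].
Proof.
move=> bx; pose m := order pi x; have m0 : (0 < m)%N := order_gt0 pi x.
have pim : iter m pi x = x := iter_order pi_inj x.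
have pi_mod n1 n2 : (n1 < m)%N -> (n2 < m)%N ->
    iter n1 pi x = iter n2 pi x -> n1 = n2.
  move=> l1 l2 e; have := findex_iter l1; rewrite e findex_iter //.
have ral u : reach u (al u) by apply: connect1; rewrite /stack_rel /= eqxx.
have rbe u : reach u (be u) by apply: connect1; rewrite /stack_rel /= eqxx orbT.
have rit n : reach x (iter n pi x).
  elim: n => [|n IH]; first exact: connect0.
  exact: connect_trans IH (connect_trans (ral _) (rbe _)).
have orb z : reach x z -> fconnect pi x z.
  have cal u : fconnect pi x u -> fconnect pi x (al u).
    move=> /iter_findex <-; elim: (findex _ _ _) => [|n IH] /=.
      by rewrite (fconnect_sym pi_inj) -[X in fconnect _ _ X]bx -{2}[x]alK
        fconnect1.
    apply: connect_trans IH _; rewrite (fconnect_sym pi_inj).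
    set w := iter n pi x.
    have -> : al w = pi (al (pi w)) by rewrite /pi !alK beK.
    exact: fconnect1.
  have cbe u : fconnect pi x u -> fconnect pi x (be u).
    move=> /cal cu; have -> : be u = pi (al u) by rewrite /pi alK.
    exact: connect_trans cu (fconnect1 _ _).
  move=> /connectP [p pp ->]; elim/last_ind: p pp => [|p v IH]; first by [].
  rewrite rcons_path last_rcons => /andP [/IH cu] /orP [] /eqP ->.
    exact: cal.
  exact: cbe.
have per n : (0 < n < m + m)%N -> iter n pi x = x -> n = m.
  move=> /andP[n0 n2m] e; case: (ltnP n m) => [nm|mn].
    by have := pi_mod _ _ nm m0 e; move=> n00; rewrite n00 in n0.
  have e' : iter (n - m) pi x = x by rewrite -{1}pim -iterD subnK.
  have lt : (n - m < m)%N by lia.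
  by have := pi_mod _ _ lt m0 e'; lia.
have fixbe k : be (iter k pi x) = iter k pi x -> (0 < k < m)%N -> k = m./2.
  move=> bk k0; have := iter_pi_be k x; rewrite bk bx -iterD => e.
  by have := per _ _ e; lia.
have fixal k : al (iter k pi x) = iter k pi x -> (k < m)%N -> k = m./2.
  move=> ak km; have := iter_pi_al k x; rewrite ak -iterD => e.
  have : iter (k + k).+1 pi x = x by rewrite iterS e /pi alK bx.
  by move=> /per; lia.
have half : (m./2 < m)%N by lia.
have fixh : al (iter m./2 pi x) = iter m./2 pi x \/
            be (iter m./2 pi x) = iter m./2 pi x.
  case: (boolP (odd m)) => om.
    left; apply: (@iter_pi_inj m./2.+1).
    rewrite iterS iter_pi_al /pi alK bx -iterD.
    by rewrite (_ : (_ + _)%N = m) ?pim //; lia.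
  right; apply: (@iter_pi_inj m./2).
  rewrite iter_pi_be bx -iterD.
  by rewrite (_ : (_ + _)%N = m) ?pim //; lia.
exists (iter m./2 pi x); split=> //.
  apply/eqP => e; have h0 : m./2 = 0%N by apply: pi_mod.
  rewrite h0 /= in fixh.
  have ax : al x = x.
    have m1 : m = 1%N by lia.
    by have := pim; rewrite m1 /= /pi => /(congr1 be); rewrite beK bx.
  exact: (nofix ax).
move=> z /orb cz zx fz; have km := findex_max cz.
rewrite -(iter_findex cz) in fz zx *.
have k0 : (0 < findex pi x z)%N.
  by case: (findex pi x z) zx => //=; rewrite eqxx.
by case: fz => [/fixal|/fixbe] -> //; rewrite k0.
Qed.

End Involutions.

(* An r-strand Brauer diagram is a perfect matching of the r top vertices [inl p]
   and the r bottom vertices [inr p], encoded as a fixed-point-free involution. *)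
Section Diagrams.
Variable r : nat.

Definition vert := ('I_r + 'I_r)%type.

Definition is_matching (d : {ffun vert -> vert}) :=
  [forall x, (d x != x) && (d (d x) == x)].

Record diagram := Diagram {dfun :> {ffun vert -> vert}; _ : is_matching dfun}.

HB.instance Definition _ := [isSub for dfun].
HB.instance Definition _ := [Finite of diagram by <:].

Lemma diagramK (d : diagram) : involutive d.
Proof. by move=> x; case: d => d /= /forallP /(_ x) /andP[_ /eqP]. Qed.

Lemma diagram_neq (d : diagram) x : d x != x.
Proof. by case: d => d /= /forallP /(_ x) /andP[]. Qed.

Definition id_fun : {ffun vert -> vert} :=
  [ffun x => match x with inl p => inr p | inr p => inl p end].

Definition s_fun (i j : 'I_r) : {ffun vert -> vert} :=
  [ffun x => match x with
    inl p => inr (tperm i j p) | inr p => inl (tperm i j p) end].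

(* For i = j this degenerates to the identity diagram; it is only used with
   j = i.+1. *)
Definition e_fun (i j : 'I_r) : {ffun vert -> vert} :=
  [ffun x => let t := tperm i j in match x with
    inl p => if t p == p then inr p else inl (t p)
  | inr p => if t p == p then inl p else inr (t p) end].

Fact id_fun_matching : is_matching id_fun.
Proof. by apply/forallP => -[] p; rewrite !ffunE /= eqxx. Qed.

Fact s_fun_matching i j : is_matching (s_fun i j).
Proof. by apply/forallP => -[] p; rewrite !ffunE /= tpermK eqxx. Qed.

Fact e_fun_matching i j : is_matching (e_fun i j).
Proof.
apply/forallP => -[] p; rewrite !ffunE /=.
  case: (tperm i j p =P p) => [tp|/eqP tp] /=; first by rewrite tp eqxx.
  by rewrite tpermK (inj_eq inl_inj) tp (eq_sym p) (negbTE tp) eqxx.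
case: (tperm i j p =P p) => [tp|/eqP tp] /=; first by rewrite tp eqxx.
by rewrite tpermK (inj_eq inr_inj) tp (eq_sym p) (negbTE tp) eqxx.
Qed.

Definition id_diag := Diagram id_fun_matching.
Definition s_diag i j := Diagram (s_fun_matching i j).
Definition e_diag i j := Diagram (e_fun_matching i j).

(* The vertices of the picture obtained by stacking a over b: [inl (inl p)] is on
   the top row, [inl (inr p)] on the middle row (the bottom of a glued to the top
   of b), and [inr p] on the bottom row.  The edges are those of a, recorded by
   [upper_act a], and those of b, recorded by [lower_act b]. *)
Definition stack := (vert + 'I_r)%type.

Definition lower_in (x : vert) : stack :=
  match x with inl p => inl (inr p) | inr p => inr p end.
Definition outer (x : vert) : stack :=
  match x with inl p => inl (inl p) | inr p => inr p end.

Definition upper_act (a : diagram) (u : stack) : stack :=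
  match u with inl x => inl (a x) | inr p => inr p end.
Definition lower_act (b : diagram) (u : stack) : stack :=
  match u with
    inl (inl p) => inl (inl p)
  | inl (inr p) => lower_in (b (inl p))
  | inr p => lower_in (b (inr p)) end.

Variables a b : diagram.

Fact upper_actK : involutive (upper_act a).
Proof. by case=> //= x; rewrite diagramK. Qed.

Let lower_act_in x : lower_act b (lower_in x) = lower_in (b x).
Proof. by case: x. Qed.

Fact lower_actK : involutive (lower_act b).
Proof.
by case=> [[p|p]|p] //=; rewrite lower_act_in diagramK.
Qed.

Let upper_fix u : upper_act a u = u <-> exists p, u = inr p.
Proof.
split=> [|[p ->] //]; case: u => [x /= [ax]|p _]; last by exists p.
by have := diagram_neq a x; rewrite ax eqxx.
Qed.

Let lower_fix u : lower_act b u = u <-> exists p, u = inl (inl p).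
Proof.
split=> [|[p ->] //]; case: u => [[p _|p]|p] /=; first by exists p.
  case E: (b _) => [q|q] //= [qp]; rewrite qp in E.
  by have := diagram_neq b (inl p); rewrite E eqxx.
case E: (b _) => [q|q] //= [qp]; rewrite qp in E.
by have := diagram_neq b (inr p); rewrite E eqxx.
Qed.

Definition joined (x y : vert) :=
  reach (upper_act a) (lower_act b) (outer x) (outer y).

(* The default x is never used, by [comp_fun_matching]. *)
Definition comp_fun : {ffun vert -> vert} :=
  [ffun x => odflt x [pick y | (y != x) && joined x y]].

(* Number of connected components of the stacked picture that stay inside the
   middle row, i.e. the closed loops removed from the product. *)
Definition loops : nat :=
  n_comp (stack_rel (upper_act a) (lower_act b))
    [pred u | [forall x, ~~ reach (upper_act a) (lower_act b) u (outer x)]].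

Let outer_inj : injective outer.
Proof. by move=> [p|p] [q|q] //= [->]. Qed.

Let joined_sym x y : joined x y = joined y x.
Proof. exact: reach_sym upper_actK lower_actK _ _. Qed.

Let joined_partner x : exists y, [/\ y != x, joined x y
  & forall z, joined x z -> z != x -> z = y].
Proof.
have outP u : upper_act a u = u \/ lower_act b u = u -> exists y, u = outer y.
  by case=> [/upper_fix|/lower_fix] [p ->]; [exists (inr p) | exists (inl p)].
have outF y : upper_act a (outer y) = outer y \/ lower_act b (outer y) = outer y.
  by case: y => p; [right | left].
have concl : (exists y, [/\ y != outer x,
      reach (upper_act a) (lower_act b) (outer x) y,
      upper_act a y = y \/ lower_act b y = y &
      forall z, reach (upper_act a) (lower_act b) (outer x) z -> z != outer x ->
        upper_act a z = z \/ lower_act b z = z -> z = y]) ->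
    exists y, [/\ y != x, joined x y
      & forall z, joined x z -> z != x -> z = y].
  move=> [w [wx jw /outP [y wy] uw]]; rewrite {w}wy in wx jw uw.
  exists y; split=> // [|z jz zx]; first by rewrite -(inj_eq outer_inj).
  by apply/outer_inj/uw; rewrite ?(inj_eq outer_inj).
apply: concl; case: x => p.
  apply: reach_partner => //; [exact: upper_actK | exact: lower_actK |].
  by move=> u /upper_fix [q ->] /lower_fix [].
have E u v : reach (upper_act a) (lower_act b) u v =
             reach (lower_act b) (upper_act a) u v.
  by apply: eq_connect => {}u {}v; rewrite /stack_rel /= orbC.
have [||u /lower_fix [q ->] /upper_fix []//||y [yx jy fy uy]] :=
  @reach_partner _ (lower_act b) (upper_act a) _ _ _ (inr p); rewrite //.
- exact: lower_actK.
- exact: upper_actK.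
exists y; split=> //; [by rewrite E | by case: fy; [right|left] |].
by move=> z; rewrite E => jz zx fz; apply: uy => //; case: fz; [right|left].
Qed.

Fact comp_fun_matching : is_matching comp_fun.
Proof.
have comp_eq x y : y != x -> joined x y -> comp_fun x = y.
  move=> yx jxy; rewrite ffunE; have [w [_ _ uw]] := joined_partner x.
  case: pickP => [z /andP[zx jz] /=|/(_ y)]; last by rewrite yx jxy.
  by rewrite (uw _ jz zx) (uw _ jxy yx).
apply/forallP => x; have [y [yx jy _]] := joined_partner x.
by rewrite (comp_eq x y) // yx (comp_eq y x) ?eqxx // 1?eq_sym // 1?joined_sym.
Qed.

Definition comp_diag := Diagram comp_fun_matching.

End Diagrams.

(* B_r(U; delta), as a free U-module; delta is a parameter of the type so that it
   determines the product [bmul]. *)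
Definition brauer (r : nat) (U : comNzRingType) (delta : U) :=
  {ffun diagram r -> U^o}.

HB.instance Definition _ r (U : comNzRingType) (delta : U) :=
  GRing.Lmodule.on (brauer r delta).

Section BrauerAlgebra.
Variables (r : nat) (U : comNzRingType) (delta : U).

Local Notation brauer := (brauer r delta).

Definition bdiag (d : diagram r) : brauer := [ffun c => (c == d)%:R].

Definition bone : brauer := bdiag (id_diag r).

Definition bmul (x y : brauer) : brauer :=
  \sum_a \sum_b (x a * y b * delta ^+ loops a b) *: bdiag (comp_diag a b).

End BrauerAlgebra.

Section Specialize.
Variables (r N : nat) (U : comNzRingType).

(* The inclusion B_r(Z; N) -> B_r(U; N) when U has characteristic 0, and the
   specialization map in general. *)
Definition bmap (x : brauer r (N%:R : int)) : brauer r (N%:R : U) :=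
  [ffun d => (x d)%:~R].

Fact bmapB : {morph bmap : x y / x - y}.
Proof. by move=> x y; apply/ffunP => d; rewrite !ffunE rmorphB. Qed.

Fact bmap1 : bmap (bone r _) = bone r _.
Proof. by apply/ffunP => d; rewrite !ffunE; case: eqP. Qed.

Fact bmapM : {morph bmap : x y / bmul x y}.
Proof.
move=> x y; apply/ffunP => d; rewrite !ffunE !sum_ffunE rmorph_sum.
apply: eq_bigr => a _; rewrite !sum_ffunE rmorph_sum; apply: eq_bigr => b _.
rewrite !ffunE /= /GRing.scale /= !rmorphM /= rmorphXn /= rmorph_nat.
by rewrite rmorph_nat.
Qed.

End Specialize.

(* End(T) acting on the right: f * g is "first f, then g".  It is a ring in which
   1 = 0 is allowed, so that T may be the zero space. *)
Section RightEnd.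
Variables (F : fieldType) (T : vectType F).

Definition rEnd := 'End(T).
HB.instance Definition _ := GRing.Lmodule.on rEnd.

Definition rEnd_mul (f g : rEnd) : rEnd := (g \o f)%VF.

Fact rEnd_mulA : associative rEnd_mul.
Proof. by move=> f g h; rewrite /rEnd_mul comp_lfunA. Qed.
Fact rEnd_mul1l : left_id (\1%VF : rEnd) rEnd_mul.
Proof. by move=> f; rewrite /rEnd_mul comp_lfun1r. Qed.
Fact rEnd_mul1r : right_id (\1%VF : rEnd) rEnd_mul.
Proof. by move=> f; rewrite /rEnd_mul comp_lfun1l. Qed.
Fact rEnd_mulDl : left_distributive rEnd_mul +%R.
Proof. by move=> f g h; rewrite /rEnd_mul comp_lfunDr. Qed.
Fact rEnd_mulDr : right_distributive rEnd_mul +%R.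
Proof. by move=> f g h; rewrite /rEnd_mul comp_lfunDl. Qed.

HB.instance Definition _ := GRing.Zmodule_isPzRing.Build rEnd
  rEnd_mulA rEnd_mul1l rEnd_mul1r rEnd_mulDl rEnd_mulDr.

Definition rapp (x : T) (f : rEnd) : T := (f : 'End(T)) x.

End RightEnd.

Section TensorPower.
Variables (F : fieldType) (V : vectType F).

Definition bas (a : 'I_(\dim {:V})) : V := (vbasis {:V})`_a.

(* The r-th tensor power of V, given by coordinates in the basis of tensors of
   basis vectors of V; [tens x] is the pure tensor x_1 (x) ... (x) x_r. *)
Definition tpow (r : nat) := {ffun {ffun 'I_r -> 'I_(\dim {:V})} -> F^o}.
HB.instance Definition _ r := Vector.on (tpow r).

Definition tens r (x : 'I_r -> V) : tpow r :=
  [ffun m : {ffun 'I_r -> 'I_(\dim {:V})} =>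
    \prod_(p < r) coord (vbasis {:V}) (m p) (x p)].

Variable f : {symmetric V}.

Definition gram : 'M[F]_(\dim {:V}) := \matrix_(a, b) f (bas a) (bas b).

(* The dual basis v_b^* with (v_a, v_b^* ) = delta_ab, see [dual_basP]. *)
Definition dual_bas (b : 'I_(\dim {:V})) : V :=
  \sum_c invmx gram c b *: bas c.

Lemma gram_unit : nondegenerate f -> gram \in unitmx.
Proof.
move=> nd; rewrite -row_free_unit -kermx_eq0; apply/rowV0P => u.
move=> /sub_kermxP ug.
pose v := \sum_a u 0 a *: bas a.
have vb b : f v (bas b) = 0.
  have := congr1 (fun M : 'rV_ _ => M 0 b) ug; rewrite !mxE => <-.
  rewrite linear_sumlz; apply: eq_bigr => a _.
  by rewrite linearZl_LR !mxE.
have v0 : v = 0.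
  apply/eqP; rewrite -memv0 -(eqP nd); apply/mem_orthovP => w _.
  rewrite (coord_vbasis (memvf w)) linear_sumr big1 // => b _.
  by rewrite linearZr_LR /= vb mulr0.
apply/rowP => a; rewrite mxE.
by have /freeP -> := basis_free (vbasisP {:V}).
Qed.

Lemma dual_basP : nondegenerate f ->
  forall a b, f (bas a) (dual_bas b) = (a == b)%:R.
Proof.
move=> /gram_unit gu a b; rewrite /dual_bas linear_sumr.
have := congr1 (fun M : 'M_ _ => M a b) (mulmxV gu); rewrite !mxE => <-.
by apply: eq_bigr => c _; rewrite linearZr_LR !mxE mulrC.
Qed.

End TensorPower.

(* Brauer's homomorphism Psi_r : B_r(F; N) -> End(V^{(x) r}), N = dim V.  The
   strands i, j = i + 1 in [bpsi_s] and [bpsi_e] are numbered from 0; the right-hand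
   side of [bpsi_e] is x E_i with omega = sum_a v_a^* (x) v_a inserted in places
   i, j.  Since the pure tensors span V^{(x) r} and the e_i, s_i generate the
   algebra, these conditions determine Psi_r. *)
Record brauer_hom (F : fieldType) (V : vectType F) (f : {symmetric V})
    (r : nat) := BrauerHom {
  bpsi :> {linear brauer r ((\dim {:V})%:R : F) -> rEnd (tpow V r)};
  bpsi1 : bpsi (bone r _) = 1;
  bpsiM : {morph bpsi : x y / bmul x y >-> x * y};
  bpsi_s : forall i j : 'I_r, j = i.+1 :> nat -> forall x : 'I_r -> V,
    rapp (tens x) (bpsi (bdiag _ (s_diag i j))) = tens (x \o tperm i j);
  bpsi_e : forall i j : 'I_r, j = i.+1 :> nat -> forall x : 'I_r -> V,
    rapp (tens x) (bpsi (bdiag _ (e_diag i j))) =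
      f (x i) (x j) *:
        \sum_a tens [eta x with i |-> dual_bas f a, j |-> bas a]
}.

Section Centralizer.
Variables (F : fieldType) (V : vectType F) (f : {symmetric V}) (r : nat).
Variable Psi : brauer_hom f r.

(* [bca] is A_r(F), the image of Psi_r; [bcaZ] is the image of B_r(Z; N) under
   Psi_r. *)
Definition bca_pred : {pred rEnd (tpow V r)} :=
  fun g => `[< exists x, Psi x = g >].

Fact bca_subring : subring_closed bca_pred.
Proof.
split=> [|g h|g h]; first by apply/asboolP; exists (bone r _); exact: bpsi1.
  by move=> /asboolP[x <-] /asboolP[y <-]; apply/asboolP; exists (x - y);
    rewrite linearB.
by move=> /asboolP[x <-] /asboolP[y <-]; apply/asboolP; exists (bmul x y);
  exact: bpsiM.
Qed.

Fact bca_submod : submod_closed bca_pred.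
Proof.
split=> [|c g h]; first by apply/asboolP; exists 0; rewrite linear0.
by move=> /asboolP[x <-] /asboolP[y <-]; apply/asboolP; exists (c *: x + y);
  rewrite linearP.
Qed.

HB.instance Definition _ := GRing.isSubringClosed.Build _ bca_pred bca_subring.
HB.instance Definition _ := GRing.isSubmodClosed.Build _ _ bca_pred bca_submod.

Record bca := Bca {bca_val :> rEnd (tpow V r); _ : bca_val \in bca_pred}.

HB.instance Definition _ := [isSub for bca_val].
HB.instance Definition _ := [Choice of bca by <:].
HB.instance Definition _ := 
  GRing.SubChoice_isSubPzRing.Build _ _ bca (subringClosedP _).
HB.instance Definition _ := [SubZmodule_isSubLmodule of bca by <:].

Definition bcaZ_pred : {pred rEnd (tpow V r)} :=
  fun g => `[< exists x : brauer r (_ : int), Psi (bmap F x) = g >].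

Fact bcaZ_subring : subring_closed bcaZ_pred.
Proof.
split=> [|g h|g h].
- by apply/asboolP; exists (bone r _); rewrite bmap1 bpsi1.
- by move=> /asboolP[x <-] /asboolP[y <-]; apply/asboolP; exists (x - y);
    rewrite bmapB linearB.
by move=> /asboolP[x <-] /asboolP[y <-]; apply/asboolP; exists (bmul x y);
  rewrite bmapM bpsiM.
Qed.

HB.instance Definition _ := GRing.isSubringClosed.Build _ bcaZ_pred bcaZ_subring.

Record bcaZ := BcaZ {bcaZ_val :> rEnd (tpow V r); _ : bcaZ_val \in bcaZ_pred}.

HB.instance Definition _ := [isSub for bcaZ_val].
HB.instance Definition _ := [Choice of bcaZ by <:].
HB.instance Definition _ := 
  GRing.SubChoice_isSubPzRing.Build _ _ bcaZ (subringClosedP _).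

End Centralizer.

Section StandardForm.
Variables (F : fieldType) (N : nat).

Definition std_form (x y : 'rV[F]_N) : F := \sum_i x 0 i * y 0 (rev_ord i).

Fact std_form_bilinear : bilinear_for *%R *%R std_form.
Proof.
split=> [y c u v|x c u v]; rewrite /std_form /= mulr_sumr -big_split /=;
  by apply: eq_bigr => i _; rewrite !mxE ?mulrDl ?mulrDr ?mulrA // (mulrC c).
Qed.

HB.instance Definition _ :=
  bilinear_isBilinear.Build _ _ _ _ *%R *%R std_form std_form_bilinear.

Fact std_form_sym x y : std_form x y = (-1) ^+ false * idfun (std_form y x).
Proof.
rewrite expr0 mul1r /= /std_form (reindex_inj rev_ord_inj) /=.
by apply: eq_bigr => i _; rewrite rev_ordK mulrC.
Qed.

HB.instance Definition _ :=
  isHermitianSesquilinear.Build _ _ _ _ std_form std_form_sym.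

End StandardForm.

Arguments std_form : clear implicits.

(* The tensor product A (x)_Z K of a (possibly noncommutative) ring A with a
   commutative ring K, as a K-algebra: formal sums of pairs (a, x), the pair standing
   for the pure tensor of a and x, modulo the congruence generated by commutativity
   of the sum and additivity in each variable. *)
Section TensorZ.
Variables (A : pzRingType) (K : comNzRingType).

Implicit Types s t : seq (A * K).

Inductive tens_eq : seq (A * K) -> seq (A * K) -> Prop :=
| tens_refl s : tens_eq s s
| tens_sym s t : tens_eq s t -> tens_eq t s
| tens_trans s t u : tens_eq s t -> tens_eq t u -> tens_eq s u
| tens_cat s s' t t' :
    tens_eq s s' -> tens_eq t t' -> tens_eq (s ++ t) (s' ++ t')
| tens_catC s t : tens_eq (s ++ t) (t ++ s)
| tens_zero x : tens_eq [:: (0, x)] [::]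
| tens_addl a b x : tens_eq [:: (a + b, x)] [:: (a, x); (b, x)]
| tens_addr a x y : tens_eq [:: (a, x + y)] [:: (a, x); (a, y)].

Definition tens_eqb s t := `[< tens_eq s t >].

Fact tens_eqb_refl : reflexive tens_eqb.
Proof. by move=> s; apply/asboolP; exact: tens_refl. Qed.
Fact tens_eqb_sym : symmetric tens_eqb.
Proof. by move=> s t; apply/asboolP/asboolP; exact: tens_sym. Qed.
Fact tens_eqb_trans : transitive tens_eqb.
Proof.
by move=> t s u /asboolP st /asboolP tu; apply/asboolP; exact: tens_trans tu.
Qed.

Canonical tens_equiv := EquivRel tens_eqb
  tens_eqb_refl tens_eqb_sym tens_eqb_trans.

Definition tensorZ := {eq_quot tens_equiv}%qT.
HB.instance Definition _ := Choice.on tensorZ.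

Definition sumt (s : seq (A * K)) : tensorZ := (\pi_({eq_quot tens_equiv}) s)%qT.

Definition pure (a : A) (x : K) : tensorZ := sumt [:: (a, x)].

Lemma sumtP s t : reflect (tens_eq s t) (sumt s == sumt t).
Proof. by rewrite /sumt eqmodE; exact: asboolP. Qed.

Lemma sumtW (P : tensorZ -> Prop) : (forall s, P (sumt s)) -> forall u, P u.
Proof. by move=> h u; rewrite -[u]reprK; exact: h. Qed.

Fact sumt_repr s : tens_eq (repr (sumt s)) s.
Proof. by apply/sumtP; rewrite /sumt reprK. Qed.

Lemma sumt_eq s t : tens_eq s t -> sumt s = sumt t.
Proof. by move=> /sumtP /eqP. Qed.

Definition addt (u v : tensorZ) : tensorZ := sumt (repr u ++ repr v).
Definition oppt (u : tensorZ) : tensorZ :=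
  sumt [seq (- w.1, w.2) | w <- repr u].
Definition scalet (c : K) (u : tensorZ) : tensorZ :=
  sumt [seq (w.1, c * w.2) | w <- repr u].
Definition mult (u v : tensorZ) : tensorZ :=
  sumt [seq (w.1 * z.1, w.2 * z.2) | w <- repr u, z <- repr v].

Let tens_map (h : A -> A) (k : K -> K) s t : h 0 = 0 ->
    {morph h : a b / a + b} -> {morph k : x y / x + y} -> tens_eq s t ->
  tens_eq [seq (h w.1, k w.2) | w <- s] [seq (h w.1, k w.2) | w <- t].
Proof.
move=> h0 hD kD; elim=> {s t} /=.
- by move=> s; exact: tens_refl.
- by move=> s t _; exact: tens_sym.
- by move=> s t u _ st _; exact: tens_trans.
- by move=> s s' t t' _ IHs _ IHt; rewrite !map_cat; exact: tens_cat.
- by move=> s t; rewrite !map_cat; exact: tens_catC.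
- by move=> x; rewrite h0; exact: tens_zero.
- by move=> a b x; rewrite hD; exact: tens_addl.
- by move=> a x y; rewrite kD; exact: tens_addr.
Qed.

Let tens_shuffle s1 s2 t1 t2 :
  tens_eq ((s1 ++ s2) ++ (t1 ++ t2)) ((s1 ++ t1) ++ (s2 ++ t2)).
Proof.
rewrite -!catA; apply: tens_cat; first exact: tens_refl.
by rewrite !catA; apply: tens_cat; [exact: tens_catC | exact: tens_refl].
Qed.

Let tens_split (f g h : A * K -> A * K) s :
    (forall w, tens_eq [:: f w] [:: g w; h w]) ->
  tens_eq (map f s) (map g s ++ map h s).
Proof.
move=> fgh; elim: s => [|w s IH] /=; first exact: tens_refl.
apply: tens_trans (tens_shuffle [:: g w] [:: h w] _ _).
exact: (tens_cat (fgh w) IH).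
Qed.

Let tens_null (f : A * K -> A * K) s :
  (forall w, tens_eq [:: f w] [::]) -> tens_eq (map f s) [::].
Proof.
move=> f0; elim: s => [|w s IH] /=; first exact: tens_refl.
exact: (tens_cat (f0 w) IH).
Qed.

Let prodt s t := [seq (w.1 * z.1, w.2 * z.2) | w <- s, z <- t].

Let prodt_r s t t' : tens_eq t t' -> tens_eq (prodt s t) (prodt s t').
Proof.
move=> tt'; elim: s => [|w s IH] /=; first exact: tens_refl.
apply: tens_cat IH; apply: (@tens_map ( *%R w.1) ( *%R w.2)) tt'.
- exact: mulr0.
- exact: mulrDr.
- exact: mulrDr.
Qed.

Let prodt_l s s' t : tens_eq s s' -> tens_eq (prodt s t) (prodt s' t).
Proof.
elim=> {s s'}.
- by move=> s; exact: tens_refl.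
- by move=> s s' _; exact: tens_sym.
- by move=> s s' s2 _ + _; exact: tens_trans.
- by move=> s s' u u' _ ? _ ?; rewrite /prodt !allpairs_cat; exact: tens_cat.
- by move=> s s'; rewrite /prodt !allpairs_cat; exact: tens_catC.
- move=> x; rewrite /prodt /= cats0; apply: tens_null => w.
  by rewrite mul0r; exact: tens_zero.
- move=> a b x; rewrite /prodt /= !cats0; apply: tens_split => w.
  by rewrite mulrDl; exact: tens_addl.
- move=> a x y; rewrite /prodt /= !cats0; apply: tens_split => w.
  by rewrite mulrDl; exact: tens_addr.
Qed.

Let prodt_Dr s t u : tens_eq (prodt s (t ++ u)) (prodt s t ++ prodt s u).
Proof.
elim: s => [|w s IH]; first exact: tens_refl.
rewrite /prodt /= map_cat; apply: tens_trans (tens_shuffle _ _ _ _).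
exact: tens_cat (tens_refl _) IH.
Qed.

Let prodtA s t u : prodt s (prodt t u) = prodt (prodt s t) u.
Proof.
have consE w s1 t1 : prodt (w :: s1) t1 =
  [seq (w.1 * z.1, w.2 * z.2) | z <- t1] ++ prodt s1 t1 by [].
have catE s1 s2 t1 : prodt (s1 ++ s2) t1 = prodt s1 t1 ++ prodt s2 t1.
  exact: allpairs_cat.
elim: s => [|w s IH] //; rewrite !consE catE IH; congr cat.
elim: t {IH} => [|z t IH] //; rewrite /= !consE map_cat IH; congr cat.
by rewrite -map_comp; apply: eq_map => x /=; rewrite !mulrA.
Qed.

Fact sumtD s t : addt (sumt s) (sumt t) = sumt (s ++ t).
Proof. by apply/sumt_eq/tens_cat; exact: sumt_repr. Qed.

Fact sumtN s : oppt (sumt s) = sumt [seq (- w.1, w.2) | w <- s].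
Proof.
apply/sumt_eq; apply: (@tens_map (@GRing.opp A) id); last exact: sumt_repr.
- exact: oppr0.
- exact: opprD.
- by [].
Qed.

Fact sumtZ c s : scalet c (sumt s) = sumt [seq (w.1, c * w.2) | w <- s].
Proof.
apply/sumt_eq; apply: (@tens_map id ( *%R c)); last exact: sumt_repr.
- by [].
- by [].
- exact: mulrDr.
Qed.

Fact sumtM s t : mult (sumt s) (sumt t) =
  sumt [seq (w.1 * z.1, w.2 * z.2) | w <- s, z <- t].
Proof.
apply/sumt_eq; apply: tens_trans (prodt_l _ (sumt_repr s)).
exact: prodt_r (sumt_repr t).
Qed.

Fact addtA : associative addt.
Proof.
by elim/sumtW=> s; elim/sumtW=> t; elim/sumtW=> u; rewrite !sumtD catA.
Qed.
Fact addtC : commutative addt.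
Proof.
by elim/sumtW=> s; elim/sumtW=> t; rewrite !sumtD; apply/sumt_eq/tens_catC.
Qed.
Fact add0t : left_id (sumt [::]) addt.
Proof. by elim/sumtW=> s; rewrite sumtD. Qed.
Fact addNt : left_inverse (sumt [::]) oppt addt.
Proof.
elim/sumtW=> s; rewrite sumtN sumtD; apply/sumt_eq.
rewrite -{2}[s]map_id.
apply: (@tens_trans _ [seq (0, w.2) | w <- s]).
  apply/tens_sym/tens_split => w; rewrite -(addNr w.1).
  by have := tens_addl (- w.1) w.1 w.2; rewrite -surjective_pairing.
by apply: tens_null => w; exact: tens_zero.
Qed.
HB.instance Definition _ := GRing.isZmodule.Build tensorZ
  addtA addtC add0t addNt.

Fact multA : associative mult.
Proof.
by elim/sumtW=> s; elim/sumtW=> t; elim/sumtW=> u; rewrite !sumtM; congr sumt; exact: prodtA.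
Qed.
Fact mul1t : left_id (pure 1 1) mult.
Proof.
elim/sumtW=> s; rewrite sumtM /= cats0; congr sumt.
by rewrite -[RHS]map_id; apply: eq_map => -[a x] /=; rewrite !mul1r.
Qed.
Fact mult1 : right_id (pure 1 1) mult.
Proof.
elim/sumtW=> s; rewrite sumtM; congr sumt.
by elim: s => //= -[a x] s ->; rewrite !mulr1.
Qed.
Fact multDl : left_distributive mult addt.
Proof.
elim/sumtW=> s; elim/sumtW=> t; elim/sumtW=> u.
by rewrite !(sumtD, sumtM) allpairs_cat.
Qed.
Fact multDr : right_distributive mult addt.
Proof.
elim/sumtW=> s; elim/sumtW=> t; elim/sumtW=> u.
by rewrite !(sumtD, sumtM); apply/sumt_eq/prodt_Dr.
Qed.
HB.instance Definition _ := GRing.Zmodule_isPzRing.Build tensorZ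
  multA mul1t mult1 multDl multDr.

Fact scaletA c d u : scalet c (scalet d u) = scalet (c * d) u.
Proof.
elim/sumtW: u => s; rewrite !sumtZ -map_comp; congr sumt.
by apply: eq_map => w /=; rewrite mulrA.
Qed.
Fact scale1t : left_id 1 scalet.
Proof.
elim/sumtW=> s; rewrite sumtZ -[in RHS](map_id s); congr sumt.
by apply: eq_map => -[a x]; rewrite mul1r.
Qed.
Fact scaletDr : right_distributive scalet +%R.
Proof.
move=> c; elim/sumtW=> s; elim/sumtW=> t.
by rewrite [X in scalet c X]sumtD !sumtZ [RHS]sumtD map_cat.
Qed.
Fact scaletDl u : {morph scalet^~ u : c d / c + d}.
Proof.
elim/sumtW: u => s c d; rewrite !sumtZ [RHS]sumtD; apply/sumt_eq/tens_split => w.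
by rewrite mulrDl; exact: tens_addr.
Qed.
HB.instance Definition _ := GRing.Zmodule_isLmodule.Build K tensorZ
  scaletA scale1t scaletDr scaletDl.

End TensorZ.

(* Main.v *)
(* Colour the 2r vertices with N = dim V colours, and let L be the set of linear
   combinations x of diagrams such that, for every colouring m, the coefficients of
   the diagrams all of whose edges are monochromatic for m add up to 0.

   The kernel of Psi is L, over every field of characteristic not 2 and for every
   nondegenerate form: in an orthogonal basis (w_a) the matrix coefficient of a
   diagram d at a colouring m vanishes unless d is monochromatic for m, and is then
   the product over the edges of the numbers f(w_a, w_a), which only depends on m.

   The definition of L makes sense over any ring, and L has a complement
   independent of the ring.  Call a diagram good if it has no increasing subsequence
   of length N + 1, as an involution of 2r ordered points.
   If d increases on a set C with N + 1 points, antisymmetrizing d over the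
   permutations of C gives an element of L, since two points of C have the same
   colour; all its terms other than d are lexicographically larger than d.  So modulo
   L every diagram is an integral combination of good ones.
   Conversely, colour each point of a good d by the length of a longest increasing
   sequence ending there: d decreases on each colour class, hence it is
   lexicographically maximal among the diagrams monochromatic for this colouring, and
   a combination of good diagrams that lies in L is 0.

   Thus A_r(Z) = B_r(Z) / L(Z) and A_r(k) = B_r(k) / L(k) have the classes of the
   good diagrams as bases. *)
From HB Require Import structures.
Require Import Defs.
From mathcomp Require Import all_boot all_order all_algebra fingroup perm zify.
From mathcomp Require Import boolp reals.
From mathcomp.real_closed Require Import complex.

Set Implicit Arguments.
Unset Strict Implicit.
Unset Printing Implicit Defensive.

Import GRing.Theory.
Local Open Scope ring_scope.

(** * Colourings and the lexicographic order *)

Section Conjugation.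
Variable r : nat.
Implicit Types (d : diagram r) (s : {perm vert r}).

Lemma diagramP d d' : d =1 d' <-> d = d'.
Proof.
by split=> [e|->//]; apply: val_inj; apply/ffunP => x; exact: e.
Qed.

(** The edge joining [u] and [d u] is moved to the one joining [s u] and [s (d u)]. The permutations
    act on all 2r points and may mix the two rows. *)
Definition conj_fun s d : {ffun vert r -> vert r} := [ffun x => s (d (s^-1%g x))].

Fact conj_fun_matching s d : is_matching (conj_fun s d).
Proof.
apply/forallP => x; rewrite !ffunE permK diagramK permKV eqxx andbT.
by rewrite -{2}[x](permKV s) (inj_eq perm_inj) diagram_neq.
Qed.

Definition conj_diag s d : diagram r := Diagram (conj_fun_matching s d).

Lemma conj_diagE s d x : conj_diag s d x = s (d (s^-1%g x)).
Proof. by rewrite [LHS]ffunE. Qed.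

Lemma conj_tpermK x y : involutive (conj_diag (tperm x y)).
Proof. by move=> d; apply/diagramP => z; rewrite !conj_diagE tpermV !tpermK. Qed.

End Conjugation.

Section Colorings.
Variables (r N : nat).

Definition colors (d : diagram r) (m : vert r -> 'I_N) :=
  [forall u, m (d u) == m u].

(** This is membership in the space L. Only sums occur, so the same definition serves integers and
    scalars of a field. *)
Definition color_null (U : nmodType) (x : {ffun diagram r -> U}) :=
  forall m : vert r -> 'I_N, \sum_(d | colors d m) x d = 0.

Lemma color_null0 (U : nmodType) : color_null (0 : {ffun diagram r -> U}).
Proof. by move=> m; rewrite big1 // => d _; rewrite ffunE. Qed.

Lemma color_nullD (U : nmodType) (x y : {ffun diagram r -> U}) :
  color_null x -> color_null y -> color_null (x + y).
Proof.
move=> hx hy m; rewrite (eq_bigr (fun d => x d + y d)) => [|d _]; last by rewrite ffunE.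
by rewrite big_split /= hx hy addr0.
Qed.

Lemma color_nullN (U : zmodType) (x : {ffun diagram r -> U}) :
  color_null x -> color_null (- x).
Proof.
move=> hx m; rewrite (eq_bigr (fun d => - x d)) => [|d _]; last by rewrite ffunE.
by rewrite sumrN hx oppr0.
Qed.

Lemma colors_conj (m : vert r -> 'I_N) s d :
  colors (conj_diag s d) m = colors d (m \o s).
Proof.
apply/forallP/forallP => h u /=.
  by have := h (s u); rewrite conj_diagE permK.
by have := h (s^-1%g u); rewrite conj_diagE /= permKV.
Qed.

End Colorings.

(** * Lexicographic order, increasing chains and good diagrams *)

Section LexOrder.
Variable r : nat.
Implicit Types (d : diagram r) (u v : vert r).

(** Orders the 2r points: the top row from left to right, then the bottom row. *)
Definition vkey u : nat := unsplit u.

Lemma vkey_inj : injective vkey.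
Proof. by move=> u v /ord_inj; exact: (can_inj unsplitK). Qed.

Definition lexd d d' := [exists p,
  [forall q, (vkey q < vkey p)%N ==> (d q == d' q)] && (vkey (d p) < vkey (d' p))%N].

Lemma lexdP d d' : reflect (exists p,
  (forall q, (vkey q < vkey p)%N -> d q = d' q) /\ (vkey (d p) < vkey (d' p))%N)
  (lexd d d').
Proof.
apply: (iffP existsP) => -[p].
  by move=> /andP[/forallP h lt]; exists p; split=> // q /(implyP (h q)) /eqP.
by move=> [h lt]; exists p; rewrite lt andbT; apply/forallP => q; apply/implyP => /h ->.
Qed.

Lemma lexd_irr d : lexd d d = false.
Proof. by apply/lexdP => -[p []]; rewrite ltnn. Qed.

Lemma lexd_trans : transitive lexd.
Proof.
move=> d' d d'' /lexdP[p [hp ltp]] /lexdP[q [hq ltq]].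
apply/lexdP; case: (ltngtP (vkey p) (vkey q)) => [lt|lt|/vkey_inj e].
- exists p; split=> [x xp|]; last by rewrite -(hq p lt).
  by rewrite hp // hq // (ltn_trans xp).
- exists q; split=> [x xq|]; last by rewrite (hp q lt).
  by rewrite hp ?hq // (ltn_trans xq).
subst q; exists p; split=> [x xp|]; last exact: ltn_trans ltq.
by rewrite hp ?hq.
Qed.

Lemma lexd_neqP d d' : d <> d' -> exists p,
  (forall q, (vkey q < vkey p)%N -> d q = d' q) /\ d p != d' p.
Proof.
move=> ne; have [p0 np0] : exists p, d p != d' p.
  apply/existsP; apply: contra_notT ne; rewrite negb_exists => /forallP h.
  by apply/diagramP => u; have /negbNE/eqP := h u.
have [p np pmin] := @arg_minnP _ p0 (fun p => d p != d' p) vkey np0; exists p; split=> // q qp; apply/eqP.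
by apply: contraTT qp => /pmin; rewrite -leqNgt.
Qed.

(** There are finitely many diagrams, so the number of predecessors is a strictly decreasing
    measure. *)
Lemma lexd_ind (P : diagram r -> Prop) :
  (forall d, (forall d', lexd d' d -> P d') -> P d) -> forall d, P d.
Proof.
move=> IH d; have [n] := ubnP #|[set d' | lexd d' d]|.
elim: n d => // n IHn d dn; apply: IH => d' d'd; apply: IHn.
apply: leq_trans (_ : #|[set d'' | lexd d'' d]| <= n)%N => //.
apply: proper_card; apply/properP; split.
  by apply/subsetP => x; rewrite !inE => /lexd_trans; apply.
by exists d'; rewrite inE // lexd_irr.
Qed.

Lemma lexd_ind_gt (P : diagram r -> Prop) :
  (forall d, (forall d', lexd d d' -> P d') -> P d) -> forall d, P d.
Proof.
move=> IH d; have [n] := ubnP #|[set d' | lexd d d']|.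
elim: n d => // n IHn d dn; apply: IH => d' d'd; apply: IHn.
apply: leq_trans (_ : #|[set d'' | lexd d d'']| <= n)%N => //.
apply: proper_card; apply/properP; split.
  by apply/subsetP => x; rewrite !inE; exact: lexd_trans.
by exists d'; rewrite inE // lexd_irr.
Qed.

(* If p is the first point where d and d' differ, then [d (d' p)] cannot precede p:
   d and d' would agree there, and so at its partner [d' p]. *)
Lemma lexd_gt d d' : d <> d' ->
  (forall p, d p != d' p -> (vkey (d' p) < vkey (d p))%N ->
     (vkey (d (d' p)) < vkey p)%N) -> lexd d d'.
Proof.
move=> /lexd_neqP[p [hp np]] h; apply/lexdP; exists p; split=> //.
rewrite ltn_neqAle (inj_eq vkey_inj) np leqNgt /=; apply/negP => lt.
have lq := h p np lt; have := hp _ lq.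
by rewrite diagramK => /(congr1 d'); rewrite !diagramK => e; rewrite -e ltnn in lq.
Qed.

Lemma lexd_lt d d' : d <> d' ->
  (forall p, d p != d' p -> (vkey (d p) < vkey (d' p))%N ->
     (vkey (d (d' p)) < vkey p)%N) -> lexd d' d.
Proof.
move=> /lexd_neqP[p [hp np]] h; apply/lexdP; exists p.
split=> [q /hp //|].
rewrite ltn_neqAle (inj_eq vkey_inj) eq_sym np leqNgt /=; apply/negP => lt.
have lq := h p np lt; have := hp _ lq.
by rewrite diagramK => /(congr1 d'); rewrite !diagramK => e; rewrite -e ltnn in lq.
Qed.

Definition inc d u v :=
  (vkey u < vkey v)%N && (vkey (d u) < vkey (d v))%N.

Lemma inc_trans d : transitive (inc d).
Proof.
move=> v u w /andP[uv duv] /andP[vw dvw].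
by rewrite /inc (ltn_trans uv) // (ltn_trans duv).
Qed.

(** An involution is its own inverse, so the pairs (point, partner) form a symmetric set. This makes
    heights constant along edges. *)
Lemma inc_diag d u v : inc d (d u) (d v) = inc d u v.
Proof. by rewrite /inc !diagramK andbC. Qed.

(* [chain d n u]: some inc-chain of n + 1 vertices ends at u. *)
Fixpoint chain d n u := if n is n'.+1 then [exists v, inc d v u && chain d n' v] else true.

Lemma chain_diag d n u : chain d n (d u) = chain d n u.
Proof.
elim: n u => //= n IH u; apply/existsP/existsP => -[v /andP[iv cv]]; exists (d v).
  by rewrite IH cv andbT -inc_diag diagramK.
by rewrite IH cv andbT inc_diag.
Qed.

Lemma chainP d n u : chain d n u ->
  exists s : seq (vert r), [/\ size s = n.+1, last u s = u & sorted (inc d) s].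
Proof.
elim: n u => [|n IH] u /=; first by exists [:: u].
case/existsP => v /andP[vu /IH[s [sz ls st]]]; exists (rcons s u).
rewrite size_rcons sz last_rcons; split=> //.
by case: s sz ls st => //= a s _ ls st; rewrite rcons_path st ls.
Qed.

Definition good N d := [forall u, ~~ chain d N u].

(** Lengths are counted from 0, so that on a good diagram the values lie below [N] and can serve as
    colours. *)
Definition height N d u : nat := \max_(n < N | chain d n u) n.

Lemma height_diag N d u : height N d (d u) = height N d u.
Proof. by apply: eq_bigl => n; rewrite chain_diag. Qed.

Lemma height_lt N d u : good N d -> (height N d u < N)%N.
Proof.
move=> /forallP /(_ u); rewrite /height; case: N => [//|N] _.
by rewrite ltnS; apply/bigmax_leqP => n _; rewrite -ltnS.
Qed.

(** A longest chain ending at [u] can be prolonged by [v]; goodness keeps the new length inside the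
    range of the maximum. *)
Lemma height_inc N d u v : good N d -> inc d u v -> (height N d u < height N d v)%N.
Proof.
move=> gd iuv; have N0 : (0 < N)%N by have := height_lt u gd; lia.
have [n cn ->] : exists2 n : 'I_N, chain d n u & height N d u = n.
  have : (0 < #|[pred n : 'I_N | chain d n u]|)%N.
    by apply/card_gt0P; exists (Ordinal N0).
  by case/(eq_bigmax_cond (@nat_of_ord N)) => n; exists n.
have cv : chain d n.+1 v by apply/existsP; exists u; rewrite iuv.
have nN : (n.+1 < N)%N.
  rewrite ltn_neqAle ltn_ord andbT; apply/eqP => e.
  by move/forallP: gd => /(_ v); rewrite -e cv.
exact: (leq_bigmax_cond (F := @nat_of_ord N) (Ordinal nN)).
Qed.

End LexOrder.

(** * Straightening *)

Section Straightening.
Variables (r N : nat).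
Implicit Types (d : diagram r) (u v : vert r) (C : {set vert r}).

Definition increasing_on d C :=
  {in C &, forall u v, (vkey u < vkey v)%N -> (vkey (d u) < vkey (d v))%N}.

(** An increasing map cannot exchange the two ends of an edge. *)
Lemma increasing_disjoint d C : increasing_on d C ->
  {in C, forall u, d u \notin C}.
Proof.
move=> h u uC; apply/negP => duC.
case: (ltngtP (vkey u) (vkey (d u))) => [lt|lt|/vkey_inj e].
- by have := h _ _ uC duC lt; rewrite diagramK; lia.
- by have := h _ _ duC uC lt; rewrite diagramK; lia.
by have := diagram_neq d u; rewrite -e eqxx.
Qed.

Lemma bad_increasing d : ~~ good N d ->
  exists2 C : {set vert r}, (N < #|C|)%N & increasing_on d C.
Proof.
rewrite negb_forall => /existsP[u /negbNE /chainP[s [sz _ st]]].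
have us : uniq s.
  apply: sorted_uniq st; first exact: inc_trans.
  by move=> x; rewrite /inc ltnn.
exists [set x in s]; first by rewrite cardsE (card_uniqP us) sz.
move=> x y; rewrite !inE => xs ys xy.
have nth_lt := sorted_ltn_nth (@inc_trans r d) u st.
case: (ltngtP (index x s) (index y s)) => lt.
- have := nth_lt (index x s) (index y s); rewrite !inE !index_mem xs ys !nth_index //.
  by move=> /(_ isT isT lt) /andP[].
- have := nth_lt (index y s) (index x s); rewrite !inE !index_mem xs ys !nth_index //.
  by move=> /(_ isT isT lt) /andP[]; lia.
by move: xy; rewrite -(nth_index u xs) lt nth_index // ltnn.
Qed.

(** No edge has both ends in [C], so conjugation moves only one end of each edge meeting [C]. If the
    partner of [p] becomes smaller, monotonicity of [d] on [C] turns this into the condition of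
    [lexd_gt], whether [p] or its partner lies in [C]. *)
Lemma conj_lexd d C s : increasing_on d C -> perm_on C s -> s != 1%g ->
  lexd d (conj_diag s d).
Proof.
move=> dC sC s1; have dis := increasing_disjoint dC.
have sV : perm_on C s^-1%g by rewrite perm_onV.
have dis' u : d u \in C -> u \notin C by move=> /dis; rewrite diagramK.
have E1 u : d u \in C -> conj_diag s d u = s (d u).
  by move=> h; rewrite conj_diagE (out_perm sV) // dis'.
have E2 u : u \in C -> conj_diag s d u = d (s^-1%g u).
  by move=> h; rewrite conj_diagE (out_perm sC) // dis // perm_closed.
have E3 u : u \notin C -> d u \notin C -> conj_diag s d u = d u.
  by move=> h h'; rewrite conj_diagE (out_perm sV) // (out_perm sC).
apply: lexd_gt => [e|p].
  case/negP: s1; apply/eqP/permP => u; rewrite perm1.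
  case: (boolP (u \in C)) => [uC|/(out_perm sC)//].
  by rewrite -{1}[u](diagramK d) -E1 ?diagramK // -e diagramK.
case: (boolP (p \in C)) => pC.
  rewrite E2 // diagramK => _ lt; rewrite ltnNge leq_eqVlt; apply/negP.
  case/orP => [/eqP/vkey_inj e|/(dC _ _ pC)]; first by rewrite -e ltnn in lt.
  by rewrite perm_closed // => /(_ pC); lia.
case: (boolP (d p \in C)) => dpC; last by rewrite E3 // eqxx.
rewrite E1 // => _ lt; rewrite -[X in (_ < vkey X)%N](diagramK d).
by apply: dC => //; rewrite perm_closed.
Qed.

Lemma antisymmetrizer_null (delta : int) d C : (N < #|C|)%N ->
  color_null N (\sum_(s : {perm vert r} | perm_on C s)
    (-1) ^+ s *: bdiag delta (conj_diag s d)).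
Proof.
move=> NC m; set x := (X in \sum_(d' | _) X d').
have -> : \sum_(d' | colors d' m) x d' =
    \sum_(s : {perm vert r} | perm_on C s)
      (-1) ^+ s * (colors d (m \o s))%:R.
  rewrite (eq_bigr (fun d' => \sum_(s : {perm vert r} | perm_on C s)
      (-1) ^+ s * (d' == conj_diag s d)%:R)) => [|d' _]; last first.
    by rewrite [LHS]sum_ffunE; apply: eq_bigr => s _; rewrite !ffunE.
  rewrite exchange_big /=; apply: eq_bigr => s _; rewrite -colors_conj -mulr_sumr.
  congr (_ * _); case: (boolP (colors _ _)) => h.
    rewrite (bigD1 (conj_diag s d)) //= eqxx big1 ?addr0 // => d' /andP[_].
    by move=> /negbTE ->.
  by rewrite big1 // => d' cd'; case: eqP => // e; rewrite -e cd' in h.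
(* Pigeonhole: [C] has more points than there are colours. *)
have [c [c' [cC c'C ncc' mcc']]] :
    exists c c', [/\ c \in C, c' \in C, c != c' & m c = m c'].
  apply: contrapT => h; move: NC; rewrite ltnNge => /negP; apply.
  suff /card_in_imset <- : {in C &, injective m}.
    by rewrite -[X in (_ <= X)%N]card_ord max_card.
  move=> c c' cC c'C e; apply/eqP; apply: contra_notT h => ne.
  by exists c, c'.
set t := tperm c c'.
have tC : perm_on C t.
  by apply: subset_trans (tperm_on c c') _; rewrite subUset !sub1set cC.
have mt u : m (t u) = m u by rewrite /t; case: tpermP => // ->.
set S := (X in X = 0).
(* Multiplying by the transposition of two points of equal colour reverses the sign and keeps the
   colouring condition. *)
have SN : S = - S.
  rewrite {1}/S (reindex_inj (mulIg t)) /= -sumrN; apply: eq_big => [s|s sC].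
    apply/idP/idP => h; last exact: perm_onM.
    by rewrite -[s](mulgK t); apply: perm_onM; rewrite ?perm_onV.
  rewrite odd_permM odd_tperm ncc' signr_addb mulrN1 mulNr.
  congr (- (_ * _%:R)); congr nat_of_bool; apply: eq_forallb => u /=.
  by rewrite !permM !mt.
(* The sum is an integer, so being its own opposite forces it to be 0. *)
lia.
Qed.

Definition straight (delta : int) (x : brauer r delta) :=
  exists w : brauer r delta,
    (forall d, ~~ good N d -> w d = 0) /\ color_null N (x - w).

Lemma straightD (delta : int) (x y : brauer r delta) :
  straight x -> straight y -> straight (x + y).
Proof.
move=> [w [gw nw]] [z [gz nz]]; exists (w + z); split=> [d bd|].
  by rewrite ffunE gw // gz // addr0.
by rewrite opprD addrACA; exact: color_nullD.
Qed.

Lemma straightN (delta : int) (x : brauer r delta) : straight x -> straight (- x).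
Proof.
move=> [w [gw nw]]; exists (- w); split=> [d bd|].
  by rewrite ffunE gw // oppr0.
by rewrite -opprD; exact: color_nullN.
Qed.

Lemma color_null_straight (delta : int) (x : brauer r delta) :
  color_null N x -> straight x.
Proof. by exists 0; split=> [d _|]; rewrite ?ffunE // subr0. Qed.

(** Induction from the lexicographically largest diagrams downwards. In the antisymmetrizer [d] has
    coefficient 1, so no denominators appear. *)
Lemma straight_bdiag (delta : int) d : straight (bdiag delta d).
Proof.
elim/lexd_ind_gt: d => d IH; case: (boolP (good N d)) => gd.
  exists (bdiag delta d); split=> [d' bd'|]; last by rewrite subrr; exact: color_null0.
  by rewrite ffunE; case: eqP => // e; rewrite e gd in bd'.
have [C NC dC] := bad_increasing gd.
have := antisymmetrizer_null delta d NC.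
rewrite (bigD1 (1%g : {perm vert r})) ?perm_on1 //= odd_perm1 expr0 scale1r.
have -> : conj_diag 1 d = d.
  by apply/diagramP => u; rewrite conj_diagE invg1 !perm1.
set y := (X in bdiag _ _ + X) => nx.
rewrite -[bdiag _ _](addrK y); apply: straightD (color_null_straight nx) (straightN _).
rewrite /y; elim/big_ind: _ => [|x z|s /andP[sC s1]].
- exact/color_null_straight/color_null0.
- exact: straightD.
have := IH _ (conj_lexd dC sC s1).
by case: (odd_perm s); rewrite ?scaleN1r ?scale1r //; exact: straightN.
Qed.

Lemma color_null_good (U : nmodType) (x : {ffun diagram r -> U}) :
  (forall d, ~~ good N d -> x d = 0) -> color_null N x -> x = 0.
Proof.
move=> gx nx; apply/ffunP => d; rewrite ffunE; elim/lexd_ind: d => d IH.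
case: (boolP (good N d)) => [gd|/gx//].
pose m u := Ordinal (height_lt u gd).
have := nx m; rewrite (bigD1 d) /=; last first.
  by apply/forallP => u; rewrite -val_eqE /= height_diag.
rewrite big1 ?addr0 // => d' /andP[/forallP cd' ne]; apply/IH/lexd_lt.
  by move=> e; rewrite e eqxx in ne.
(* Were [p] before [d (d' p)], the points [d p] and [d' p] would form an increasing pair of [d]; but
   both have the height of [p]. *)
move=> p _ lt; case: (ltngtP (vkey (d (d' p))) (vkey p)) => // [lt'|/vkey_inj e].
  have /(height_inc gd) : inc d (d p) (d' p) by rewrite /inc lt diagramK.
  by rewrite height_diag; have := cd' p; rewrite -val_eqE /= => /eqP ->; rewrite ltnn.
by move: lt; rewrite -{1}e diagramK ltnn.
Qed.

End Straightening.

(** * Products with the generators *)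

Section Stacking.
Variable r : nat.
Implicit Types (a b d : diagram r).

Let rch a b := reach (upper_act a) (lower_act b).

Let rch_sym a b u v : rch a b u v -> rch a b v u.
Proof. by rewrite /rch reach_sym //; [exact: upper_actK | exact: lower_actK]. Qed.

Let rch_trans a b v u w : rch a b u v -> rch a b v w -> rch a b u w.
Proof. exact: connect_trans. Qed.

Let rch_upper a b u : rch a b u (upper_act a u).
Proof. by apply: connect1; rewrite /stack_rel /= eqxx. Qed.

Let lower_act_in b x : lower_act b (lower_in x) = lower_in (b x).
Proof. by case: x. Qed.

Let rch_lower a b x : rch a b (lower_in x) (lower_in (b x)).
Proof. by apply: connect1; rewrite /stack_rel /= lower_act_in eqxx orbT. Qed.

(** A criterion to recognise a product: the labels are constant on components of the stacked
    picture, and on the outer rows they are the edges of [d], so the only possible partner of [x] is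
    [d x]. *)
Lemma comp_diag_labelled a b d (lab : stack r -> {set vert r}) :
    (forall x, lab (outer x) = [set x; d x]) ->
    (forall u, lab (upper_act a u) = lab u) ->
    (forall x, lab (lower_in (b x)) = lab (lower_in x)) ->
    (forall x, joined a b x (d x)) -> comp_diag a b = d.
Proof.
move=> labo labu labl jd; apply/diagramP => x.
have labj y : joined a b x y -> lab (outer x) = lab (outer y).
  case/connectP => p; elim: p (outer x) => [|v p IH] u /= => [_ -> //|].
  case/andP => /orP[] /eqP -> pp lp; rewrite -(IH _ pp lp) ?labu //.
  by case: u {pp lp} => [[z|z]|z] //=; rewrite -[RHS]labl lower_act_in ?diagramK // labl.
rewrite [LHS]ffunE; case: pickP => [y /andP[yx /labj]|/(_ (d x))]; last first.
  by rewrite diagram_neq jd.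
rewrite !labo => /setP/(_ y); rewrite !inE eqxx (negbTE yx) /=.
by move/eqP.
Qed.

Lemma loops0 a b :
  (forall p, exists x, reach (upper_act a) (lower_act b) (inl (inr p)) (outer x)) ->
  loops a b = 0%N.
Proof.
move=> h; apply: eq_card0 => u; rewrite !inE; apply/negP => /andP[_ /forallP no].
case: u no => [[p|p]|p] no.
- by have /negP := no (inl p); apply; exact: connect0.
- by have [x rx] := h p; have /negP := no x; apply.
by have /negP := no (inr p); apply; exact: connect0.
Qed.

Section Transposition.
Variables (i j : 'I_r) (d : diagram r).

Let t : {perm vert r} := tperm (inl i) (inl j).

Let t_inl p : t (inl p) = inl (tperm i j p).
Proof. by rewrite -(inj_tperm _ _ _ inl_inj). Qed.

Let t_inr p : t (inr p) = inr p.
Proof. by rewrite tpermD. Qed.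

Let rch_t x : rch (s_diag i j) d (outer x) (lower_in (t x)).
Proof.
case: x => p; last by rewrite t_inr; exact: connect0.
by have := rch_upper (s_diag i j) d (outer (inl p)); rewrite /= ffunE t_inl.
Qed.

Lemma comp_s_diag : comp_diag (s_diag i j) d = conj_diag t d.
Proof.
(* The middle vertex [p] is joined by the upper diagram to the top vertex [t (inl p)], and gets its
   name. *)
pose k (u : stack r) : vert r := match u with
  inl (inl p) => inl p | inl (inr p) => t (inl p) | inr p => inr p end.
apply: (@comp_diag_labelled _ _ _ (fun u => [set k u; conj_diag t d (k u)])).
- by case.
- by case=> [[p|p]|p] //=; rewrite ffunE /= ?t_inl ?tpermK.
- have kl x : k (lower_in x) = t x by case: x => //= p; rewrite t_inr.
  move=> x; rewrite !kl !conj_diagE !tpermV !tpermK diagramK.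
  by rewrite setUC.
move=> x; apply: (rch_trans (rch_t x)); apply: (rch_trans (rch_lower _ _ _)).
by apply: rch_sym; apply: (rch_trans (rch_t _)); rewrite conj_diagE tpermV tpermK; exact: connect0.
Qed.

Lemma loops_s_diag : loops (s_diag i j) d = 0%N.
Proof.
apply: loops0 => p; exists (t (inl p)); apply: rch_sym.
by have := rch_t (t (inl p)); rewrite tpermK.
Qed.

End Transposition.

Section Contraction.
Variables (i j p q : 'I_r) (d : diagram r).
Hypotheses (dij : d (inl i) = inl j) (dpq : d (inr p) = inr q).

(** The horizontal edges ij and pq are replaced by the through strands ip and jq. Stacking
    [e_diag i j] on top recreates both: its upper edge is ij, and its lower edge links the two
    strands into pq. *)
Let d' := conj_diag (tperm (inl j) (inr p)) d.

Let ij : (i == j) = false.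
Proof. by have := diagram_neq d (inl i); rewrite dij (inj_eq inl_inj) eq_sym => /negbTE. Qed.
Let pq : (p == q) = false.
Proof. by have := diagram_neq d (inr p); rewrite dpq (inj_eq inr_inj) eq_sym => /negbTE. Qed.

Let dji : d (inl j) = inl i. Proof. by rewrite -dij diagramK. Qed.
Let dqp : d (inr q) = inr p. Proof. by rewrite -dpq diagramK. Qed.

Lemma conj_edge_i : d' (inl i) = inr p.
Proof. by rewrite conj_diagE tpermV tpermD ?dij ?tpermL // (inj_eq inl_inj) eq_sym ij. Qed.

Lemma conj_edge_j : d' (inl j) = inr q.
Proof. by rewrite conj_diagE tpermV tpermL dpq tpermD // (inj_eq inr_inj) pq. Qed.

Lemma conj_edge_p : d' (inr p) = inl i.
Proof. by rewrite -conj_edge_i diagramK. Qed.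

Lemma conj_edge_q : d' (inr q) = inl j.
Proof. by rewrite -conj_edge_j diagramK. Qed.

Lemma notin_edges x : x \notin [:: inl i; inl j; inr p; inr q] ->
  d x \notin [:: inl i; inl j; inr p; inr q].
Proof.
apply: contra; rewrite !inE => /or4P[] /eqP e;
  by rewrite -[x](diagramK d) e ?dij ?dji ?dpq ?dqp eqxx ?orbT.
Qed.

Lemma conj_edge x : x \notin [:: inl i; inl j; inr p; inr q] -> d' x = d x.
Proof.
rewrite !inE !negb_or => /and4P[xi xj xp xq].
rewrite conj_diagE tpermV tpermD; [|by rewrite eq_sym..].
rewrite tpermD // eq_sym -(inj_eq (inv_inj (diagramK d))) diagramK.
  by rewrite dji.
by rewrite dpq.
Qed.

Let rch_e x : x \notin [:: inl i; inl j] -> rch (e_diag i j) d' (outer x) (lower_in x).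
Proof.
case: x => x; last by move=> _; exact: connect0.
rewrite !inE !(inj_eq inl_inj) negb_or => /andP[xi xj].
have := rch_upper (e_diag i j) d' (outer (inl x)); rewrite /= ffunE /=.
by rewrite tpermD ?eqxx // eq_sym.
Qed.

Let rch_ij : rch (e_diag i j) d' (outer (inl i)) (outer (inl j)).
Proof.
have := rch_upper (e_diag i j) d' (outer (inl i)); rewrite /= ffunE /=.
by rewrite tpermL eq_sym ij.
Qed.

Let rch_pq : rch (e_diag i j) d' (outer (inr p)) (outer (inr q)).
Proof.
have := rch_lower (e_diag i j) d' (inr p); rewrite conj_edge_p /= => h1.
have := rch_lower (e_diag i j) d' (inr q); rewrite conj_edge_q /= => /rch_sym h2.
apply: (rch_trans h1); apply: rch_trans h2.
have := rch_upper (e_diag i j) d' (inl (inr i)); rewrite /= ffunE /=.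
by rewrite tpermL eq_sym ij.
Qed.

Lemma comp_e_diag : comp_diag (e_diag i j) d' = d.
Proof.
(* The middle vertices [i] and [j] lie on the path from [p] to [q]; every other middle vertex is
   joined to the top vertex above it. *)
pose lab (u : stack r) := match u with
  inl (inl x) => [set inl x; d (inl x)]
| inl (inr x) => if (x == i) || (x == j) then [set inr p; inr q]
                 else [set inl x; d (inl x)]
| inr x => [set inr x; d (inr x)] end.
apply: (@comp_diag_labelled _ _ _ lab).
- by case.
- case=> [[x|x]|x] //=; rewrite ffunE /=; case: tpermP => [->|->|/eqP xi /eqP xj] //=.
  + by rewrite eq_sym ij /= dij dji setUC.
  + by rewrite ij /= dij dji setUC.
  + by rewrite eqxx /= (negbTE xi) (negbTE xj).
  + by rewrite eq_sym ij /= !eqxx orbT.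
  + by rewrite ij /= !eqxx orbT.
  by rewrite eqxx /= (negbTE xi) (negbTE xj).
- move=> x; case: (boolP (x \in [:: inl i; inl j; inr p; inr q])) => [|nx].
    rewrite !inE => /or4P[] /eqP -> /=.
    + by rewrite conj_edge_i /= dpq eqxx.
    + by rewrite conj_edge_j /= dqp eqxx orbT setUC.
    + by rewrite conj_edge_p /= dpq eqxx.
    by rewrite conj_edge_q /= dqp eqxx orbT setUC.
  have nd := notin_edges nx.
  have labE y : y \notin [:: inl i; inl j; inr p; inr q] ->
      lab (lower_in y) = [set y; d y].
    case: y => // y; rewrite !inE !negb_or => /and4P[yi yj _ _] /=.
    by move: yi yj; rewrite !(inj_eq inl_inj) => /negbTE -> /negbTE ->.
  by rewrite conj_edge // !labE // diagramK setUC.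
move=> x; case: (boolP (x \in [:: inl i; inl j; inr p; inr q])) => [|nx].
  rewrite !inE /joined => /or4P[] /eqP ->; rewrite ?dij ?dji ?dpq ?dqp //;
  exact: rch_sym.
have nd := notin_edges nx.
have sub y : y \notin [:: inl i; inl j; inr p; inr q] -> y \notin [:: inl i; inl j].
  by apply: contra; rewrite !inE => /orP[] ->; rewrite ?orbT.
apply: (rch_trans (rch_e (sub _ nx))); apply: (rch_trans (rch_lower _ _ _)).
by rewrite conj_edge //; apply/rch_sym/rch_e/sub.
Qed.

Lemma loops_e_diag : loops (e_diag i j) d' = 0%N.
Proof.
apply: loops0 => x; case: (eqVneq x i) => [->|xi].
  by exists (inr p); have := rch_lower (e_diag i j) d' (inl i); rewrite conj_edge_i.
case: (eqVneq x j) => [->|xj].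
  by exists (inr q); have := rch_lower (e_diag i j) d' (inl j); rewrite conj_edge_j.
exists (inl x); apply/rch_sym/rch_e.
by rewrite !inE !(inj_eq inl_inj) negb_or xi.
Qed.

End Contraction.

End Stacking.

(** * Orthogonal bases and tensors *)

Section OrthogonalBasis.
Variables (F : fieldType) (V : vectType F) (f : {symmetric V}).
Hypothesis char2 : 2%N \notin [pchar F].

Lemma form_symC u v : f u v = f v u.
Proof. by rewrite hermC mul1r. Qed.

Let neq2 : 2%:R != 0 :> F.
Proof. by apply: contra char2 => e; rewrite inE. Qed.

(** Polarization: if [f v v] vanished on [U], then so would 2 [f u v], and [U] would be orthogonal
    to itself. The characteristic enters here. *)
Lemma anisotropic_vector (U : {vspace V}) : (U :&: orthov f U = 0)%VS -> U != 0%VS ->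
  exists2 v, v \in U & f v v != 0.
Proof.
move=> nd U0; apply: contrapT => h; case/eqP: U0.
have iso v : v \in U -> f v v = 0.
  by move=> vU; apply/eqP; apply: contra_notT h => nz; exists v.
rewrite -nd; apply/esym/capv_idPl/subvP => u uU; apply/mem_orthovP => v vU.
have := iso _ (memvD uU vU); rewrite linearDl !linearDr /= !iso // add0r addr0.
rewrite (form_symC v u) -mulr2n -mulr_natl => /eqP.
by rewrite mulf_eq0 (negbTE neq2) => /eqP.
Qed.

(** Split off an anisotropic [v] and continue in its orthogonal complement inside [U], which is
    again nondegenerate. The last clause yields expansions in the [w a]. *)
Lemma orthogonal_basis_in n (U : {vspace V}) :
    \dim U = n -> (U :&: orthov f U = 0)%VS ->
  exists w : 'I_n -> V, [/\ forall a, w a \in U,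
    forall a b, a != b -> f (w a) (w b) = 0, forall a, f (w a) (w a) != 0 &
    forall x, x \in U -> (forall a, f x (w a) = 0) -> x = 0].
Proof.
elim: n U => [|n IH] U dU nd.
  have U0 : U = 0%VS by apply/eqP; rewrite -dimv_eq0 dU.
  exists (fun=> 0); split; try by case.
  by move=> x; rewrite U0 memv0 => /eqP.
have [|v vU fv] := anisotropic_vector nd; first by rewrite -dimv_eq0 dU.
pose U' := (U :&: orthov f <[v]>)%VS.
have vN : v \notin orthov f U by apply/mem_orthovPn; exists v.
have U'P x : reflect (x \in U /\ f x v = 0) (x \in U').
  rewrite memv_cap mem_orthov1; apply: (iffP andP) => -[xU /eqP]; first by [].
  by move=> e; rewrite e.
have dU' : \dim U' = n by rewrite -(eq_dim_orthov1 vN) dU.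
have nd' : (U' :&: orthov f U' = 0)%VS.
  apply/eqP; rewrite -subv0; apply/subvP => x; rewrite memv_cap => /andP[/U'P[xU xv]].
  move/mem_orthovP => xo; rewrite -nd memv_cap xU; apply/mem_orthovP => u uU.
  (* The projection of [u] to the complement of [v]; it has the same product with [x], since [x] is
     orthogonal to [v]. *)
  pose u' := u - (f u v / f v v) *: v.
  have : u' \in U'.
    apply/U'P; rewrite memvB ?memvZ //; split=> //.
    by rewrite linearBl /= linearZl_LR /= divfK // subrr.
  by move/xo; rewrite linearBr /= linearZr_LR /= xv mulr0 subr0.
have [w [wU wo wn wx]] := IH _ dU' nd'.
pose w' (a : 'I_n.+1) := if unlift ord0 a is Some b then w b else v.
have w'0 : w' ord0 = v by rewrite /w' unlift_none.
have w'S b : w' (lift ord0 b) = w b by rewrite /w' liftK.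
have wUv b : w b \in U /\ f (w b) v = 0 by apply/U'P.
exists w'; split.
- move=> a; case: (unliftP ord0 a) => [b|] ->; rewrite ?w'0 // w'S.
  by have [] := wUv b.
- move=> a b; case: (unliftP ord0 a) => [a'|] ->; case: (unliftP ord0 b) => [b'|] ->;
    rewrite ?w'0 ?w'S ?eqxx //.
  + by rewrite (inj_eq lift_inj); exact: wo.
  + by move=> _; have [] := wUv a'.
  by move=> _; rewrite form_symC; have [] := wUv b'.
- by move=> a; case: (unliftP ord0 a) => [a'|] ->; rewrite ?w'0 ?w'S.
move=> x xU h; apply: wx => [|a]; last by rewrite -w'S.
by apply/U'P; rewrite -w'0.
Qed.

Lemma orthogonal_basis : nondegenerate f ->
  exists w : 'I_(\dim {:V}) -> V, [/\ forall a b, a != b -> f (w a) (w b) = 0,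
    forall a, f (w a) (w a) != 0 & forall x, (forall a, f x (w a) = 0) -> x = 0].
Proof.
move=> nd; have [] := @orthogonal_basis_in (\dim {:V}) {:V}%VS.
- by [].
- by rewrite capfv; apply/eqP.
by move=> w [_ wo wn wx]; exists w; split=> // x; apply: wx; rewrite memvf.
Qed.

End OrthogonalBasis.

(** * The form induced on tensor powers *)

Section TensorPairing.
Variables (F : fieldType) (V : vectType F) (f : {symmetric V}) (r : nat).
Local Notation n := (\dim {:V}).
Implicit Types (x y : 'I_r -> V) (t : tpow V r).

Lemma eq_tens x y : x =1 y -> tens x = tens y.
Proof. by move=> e; apply/ffunP => m; rewrite !ffunE; apply: eq_bigr => p _; rewrite e. Qed.

Lemma tens_slot (J : finType) (i : 'I_r) x (y : J -> 'I_r -> V) (c : J -> F) :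
    x i = \sum_b c b *: y b i -> (forall b p, p != i -> y b p = x p) ->
  tens x = \sum_b c b *: tens (y b).
Proof.
move=> xi xp; apply/ffunP => m; rewrite sum_ffunE !ffunE (bigD1 i) //= xi linear_sum.
rewrite mulr_suml; apply: eq_bigr => b _; rewrite !ffunE /= [X in _ = _ *: X](bigD1 i) //= linearZ.
rewrite -mulrA; congr (_ * (_ * _)); apply: eq_bigr => p pi.
by rewrite xp.
Qed.

Lemma tens_expand (J : finType) (w : J -> V) x (c : 'I_r -> J -> F) :
    (forall p, x p = \sum_a c p a *: w a) ->
  tens x = \sum_(m : {ffun 'I_r -> J}) (\prod_p c p (m p)) *: tens (w \o m).
Proof.
move=> xE; apply/ffunP => k; rewrite sum_ffunE !ffunE.
rewrite (eq_bigr (fun p => \sum_a c p a * coord (vbasis {:V}) (k p) (w a))); last first.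
  by move=> p _; rewrite xE linear_sum; apply: eq_bigr => a _; exact: linearZ.
rewrite bigA_distr_bigA /=; apply: eq_bigr => m _; rewrite !ffunE.
exact: big_split.
Qed.

Lemma coord_bas a b : coord (vbasis {:V}) a (bas b) = (b == a)%:R.
Proof. by rewrite /bas coord_free // (basis_free (vbasisP _)). Qed.

Lemma tens_bas (k : {ffun 'I_r -> 'I_n}) m : tens (@bas F V \o k) m = (m == k)%:R.
Proof.
rewrite ffunE; case: eqP => [->|ne].
  by rewrite big1 // => p _; rewrite coord_bas eqxx.
have [p np] : exists p, m p != k p.
  by apply/existsP; apply: contra_notT ne; rewrite negb_exists => /forallP h;
    apply/ffunP => p; have /negbNE/eqP := h p.
by rewrite (bigD1 p) //= coord_bas eq_sym (negbTE np) mul0r.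
Qed.

Lemma tpow_expand t : t = \sum_k t k *: tens (@bas F V \o k).
Proof.
apply/ffunP => m; rewrite sum_ffunE (bigD1 m) //= ffunE tens_bas eqxx.
rewrite big1 ?addr0 => [|k km]; first by rewrite /GRing.scale /= mulr1.
by rewrite ffunE tens_bas eq_sym (negbTE km) scaler0.
Qed.

(** The form induced by [f] on the tensor power, with the pure tensor of [y] as second argument. *)
Definition pair t y : F := \sum_(k : {ffun 'I_r -> 'I_n}) t k * \prod_p f (bas (k p)) (y p).

Lemma pair_is_linear y : linear_for *%R (pair^~ y).
Proof.
move=> c t t'; rewrite /pair mulr_sumr -big_split; apply: eq_bigr => k _ /=.
by rewrite !ffunE mulrDl mulrA.
Qed.

Lemma pair0 y : pair 0 y = 0.
Proof. by rewrite /pair big1 // => k _; rewrite ffunE mul0r. Qed.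

Lemma pairZ c t y : pair (c *: t) y = c * pair t y.
Proof. by have := pair_is_linear y c t 0; rewrite addr0 pair0 addr0. Qed.

Lemma pairD t t' y : pair (t + t') y = pair t y + pair t' y.
Proof. by have := pair_is_linear y 1 t t'; rewrite scale1r mul1r. Qed.

Lemma pair_sum (I : Type) (s : seq I) (P : pred I) (T : I -> tpow V r) y :
  pair (\sum_(i <- s | P i) T i) y = \sum_(i <- s | P i) pair (T i) y.
Proof. by elim/big_rec2: _ => [|i c t _ <-]; rewrite ?pair0 ?pairD. Qed.

Lemma pair_tens x y : pair (tens x) y = \prod_p f (x p) (y p).
Proof.
rewrite (eq_bigr (fun p => \sum_a coord (vbasis {:V}) a (x p) * f (bas a) (y p))).
  rewrite bigA_distr_bigA; apply: eq_bigr => k _ /=.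
  by rewrite ffunE -big_split.
move=> p _; rewrite {1}(coord_vbasis (memvf (x p))) linear_sumlz.
by apply: eq_bigr => a _; rewrite linearZl_LR.
Qed.

Lemma pair_expand (J : finType) (w : J -> V) t y (c : 'I_r -> J -> F) :
    (forall p, y p = \sum_a c p a *: w a) ->
  pair t y = \sum_(m : {ffun 'I_r -> J}) (\prod_p c p (m p)) * pair t (w \o m).
Proof.
move=> yE; rewrite /pair; under [RHS]eq_bigr do rewrite mulr_sumr.
rewrite exchange_big; apply: eq_bigr => k _ /=.
rewrite (eq_bigr (fun p => \sum_a c p a * f (bas (k p)) (w a))); last first.
  by move=> p _; rewrite yE linear_sumr; apply: eq_bigr => a _; rewrite linearZr_LR.
rewrite bigA_distr_bigA mulr_sumr; apply: eq_bigr => m _ /=.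
by rewrite big_split /= mulrCA.
Qed.

Hypothesis nd : nondegenerate f.

(** Dual basis vectors read off coordinates; hence a tensor that pairs to 0 with all pure tensors is
    0. *)
Lemma pair_dual_bas t (k : {ffun 'I_r -> 'I_n}) : pair t (dual_bas f \o k) = t k.
Proof.
rewrite /pair (bigD1 k) //= big1 ?mulr1 => [|p _]; last by rewrite dual_basP // eqxx.
rewrite big1 ?addr0 // => m mk.
have [p np] : exists p, m p != k p.
  apply/existsP; apply: contraNT mk; rewrite negb_exists => /forallP h.
  by apply/eqP/ffunP => p; have /negbNE/eqP := h p.
by rewrite (bigD1 p) //= dual_basP // (negbTE np) mul0r mulr0.
Qed.

Lemma sum_dual_bas (y : V) : \sum_a f (dual_bas f a) y *: bas a = y.
Proof.
rewrite [RHS](coord_vbasis (memvf y)); apply: eq_bigr => a _; congr (_ *: _).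
rewrite form_symC {1}(coord_vbasis (memvf y)) linear_sumlz (bigD1 a) //= linearZl_LR /=.
rewrite dual_basP // eqxx mulr1 big1 ?addr0 // => b ba.
by rewrite linearZl_LR /= dual_basP // (negbTE ba) mulr0.
Qed.

End TensorPairing.

(** * The kernel of Brauer's homomorphism *)

Lemma brauer_sum r (U : comNzRingType) (delta : U) (x : brauer r delta) :
  x = \sum_d x d *: bdiag delta d.
Proof.
apply/ffunP => d; rewrite [RHS]sum_ffunE (bigD1 d) //= !ffunE eqxx.
rewrite big1 ?addr0 => [|e ed]; first by rewrite /GRing.scale /= mulr1.
by rewrite !ffunE eq_sym (negbTE ed) scaler0.
Qed.

Lemma bmul_bdiag r (U : comNzRingType) (delta : U) (a b : diagram r) :
  bmul (bdiag delta a) (bdiag delta b) =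
    delta ^+ loops a b *: bdiag delta (comp_diag a b).
Proof.
rewrite /bmul (bigD1 a) //= (bigD1 b) //= !ffunE !eqxx !mul1r.
rewrite big1 => [|b' bb']; last by rewrite !ffunE (negbTE bb') mulr0 mul0r scale0r.
rewrite big1 ?addr0 // => a' aa'; rewrite big1 // => b' _.
by rewrite !ffunE (negbTE aa') !mul0r scale0r.
Qed.

Section Conj.
Variable r : nat.
Implicit Types (d : diagram r) (s : {perm vert r}).

Lemma conj_diagM s s' d : conj_diag (s * s')%g d = conj_diag s' (conj_diag s d).
Proof. by apply/diagramP => u; rewrite !conj_diagE invMg !permM. Qed.

Lemma conj_diag_tpermJ s x y d :
  conj_diag s (conj_diag (tperm x y) d) =
  conj_diag (tperm (s x) (s y)) (conj_diag s d).
Proof. by rewrite -!conj_diagM -tpermJ conjgE !mulgA mulgV mul1g. Qed.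

End Conj.

Section Weights.
Variables (W : finType) (n : nat) (F : comNzRingType) (g : 'I_n -> F).

(* If m colours a perfect matching of W, this is the product of the g-values of
   the colours of its edges; as written it does not refer to the matching. *)
Definition weight (m : W -> 'I_n) : F := \prod_a g a ^+ #|[pred u | m u == a]|./2.

Lemma weight_perm (m : W -> 'I_n) (s : {perm W}) : weight (m \o s) = weight m.
Proof.
apply: eq_bigr => a _; congr (_ ^+ _./2).
by rewrite -!sum1_card [RHS](reindex_inj (@perm_inj _ s)).
Qed.

(** Removing two vertices of one colour lowers the half count by exactly 1, whatever the parity of
    the rest. *)
Lemma weight_pair (m : W -> 'I_n) x y : x != y -> m x = m y ->
  weight m = g (m x) *
    \prod_a g a ^+ #|[pred u | [&& u != x, u != y & m u == a]]|./2.
Proof.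
move=> xy mxy; have E a : #|[pred u | m u == a]| =
    ((m x == a).*2 + #|[pred u | [&& u != x, u != y & m u == a]]|)%N.
  rewrite (cardD1 x) (cardD1 y) !inE (eq_sym y) xy -mxy addnA addnn; congr addn.
  by apply: eq_card => u; rewrite !inE andbCA.
rewrite /weight (bigD1 (m x)) //= [in RHS](bigD1 (m x)) //= mulrA E eqxx.
rewrite [nat_of_bool _]/= add2n /= exprS; congr (_ * _); apply: eq_bigr => a ax.
by rewrite E eq_sym (negbTE ax).
Qed.

End Weights.

(** * Matrix coefficients of diagrams in an orthogonal basis *)

Section Evaluation.
Variables (F : fieldType) (V : vectType F) (f : {symmetric V}) (r : nat).
Variable Psi : brauer_hom f r.
Hypothesis nd : nondegenerate f.
Local Notation n := (\dim {:V}).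
Local Notation bd := (bdiag (n%:R : F)).
Variable w : 'I_n -> V.
Hypotheses (w_orth : forall a b, a != b -> f (w a) (w b) = 0)
  (w_neq0 : forall a, f (w a) (w a) != 0)
  (w_full : forall x, (forall a, f x (w a) = 0) -> x = 0).

Let g a := f (w a) (w a).
Implicit Types (d : diagram r) (m : vert r -> 'I_n).

Lemma orthogonal_expand (x : V) : x = \sum_a (f x (w a) / g a) *: w a.
Proof.
apply/eqP; rewrite -subr_eq0; apply/eqP/w_full => b.
rewrite linearBl /= linear_sumlz (bigD1 b) //= linearZl_LR /= divfK ?w_neq0 //.
rewrite big1 ?addr0 ?subrr // => a ab.
by rewrite linearZl_LR /= w_orth // mulr0.
Qed.

(** A matrix coefficient of [Psi z]: the top colours give the input tensor, the bottom colours the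
    tensor it is paired with. *)
Definition amp (z : brauer r (n%:R : F)) m : F :=
  pair f (rapp (tens (w \o m \o inl)) (Psi z)) (w \o m \o inr).

(** [Psi] is prescribed on the generators only, so this formula is carried from the identity diagram
    to all others by multiplying with generators. *)
Definition evaluates d := forall m, amp (bd d) m = (colors d m)%:R * weight g m.

Lemma rappM (t : tpow V r) (h k : rEnd (tpow V r)) : rapp t (h * k) = rapp (rapp t h) k.
Proof. exact: comp_lfunE. Qed.

Lemma evaluates_id : evaluates (id_diag r).
Proof.
move=> m; rewrite /amp -[bd _]/(bone _ _) bpsi1 [rapp _ _]id_lfunE pair_tens /=.
case: (boolP (colors _ _)) => [/forallP h|].
  have e p : m (inr p) = m (inl p) by have := h (inl p); rewrite ffunE => /eqP.
  rewrite mul1r (eq_bigr (fun p => g (m (inl p)))) => [|p _]; last by rewrite e.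
  (* Strands are grouped by colour; a colour occurs on twice as many vertices as strands. *)
  rewrite (partition_big (m \o inl) xpredT) //=; apply: eq_bigr => a _.
  rewrite (eq_bigr (fun=> g a)) => [|p /eqP <- //]; rewrite prodr_const; congr (_ ^+ _).
  rewrite -[RHS]/(half _) -!sum1_card big_sumType /=.
  rewrite [X in (_ + X)%N](eq_bigl (fun p => m (inl p) == a)); last first.
    by move=> p; rewrite inE e.
  by rewrite addnn doubleK.
rewrite negb_forall => /existsP[u nu]; rewrite mul0r.
have [p np] : exists p, m (inl p) != m (inr p).
  by case: u nu => p; rewrite ffunE /= => np; exists p; rewrite // eq_sym.
by apply/eqP/prodf_eq0; exists p; rewrite ?w_orth.
Qed.

Section Adjacent.
Variables i j : 'I_r.
Hypothesis ji : j = i.+1 :> nat.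

Let t : {perm vert r} := tperm (inl i) (inl j).

Lemma evaluates_adjacent d : evaluates d -> evaluates (conj_diag t d).
Proof.
move=> ed m; rewrite colors_conj -(weight_perm g m t) -ed /amp.
have -> : bd (conj_diag t d) = bmul (bd (s_diag i j)) (bd d).
  by rewrite bmul_bdiag loops_s_diag comp_s_diag expr0 scale1r.
rewrite bpsiM rappM bpsi_s //; congr (pair _ (rapp _ _) _).
  by apply: eq_tens => p /=; rewrite -(inj_tperm _ _ _ inl_inj).
by apply/funext => p /=; rewrite tpermD.
Qed.

Let neqij : inl i != inl j :> vert r.
Proof. by rewrite (inj_eq inl_inj) -val_eqE /= ji neq_ltn ltnSn. Qed.

(** The tensor omega does not depend on the dual bases: the vectors [w b] and [w b] divided by [g b]
    are another such pair. *)
Lemma sum_dual_tens (x : 'I_r -> V) :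
  \sum_a tens [eta x with i |-> dual_bas f a, j |-> bas a] =
  \sum_b (g b)^-1 *: tens [eta x with i |-> w b, j |-> w b].
Proof.
have jni : (j == i) = false by rewrite -val_eqE /= ji eqn_leq ltnn.
pose c a b := f (dual_bas f a) (w b) / g b.
transitivity (\sum_a \sum_b c a b *: tens [eta x with i |-> w b, j |-> bas a]).
  apply: eq_bigr => a _; apply: (@tens_slot _ _ _ _ i) => /=.
    by rewrite eqxx; exact: orthogonal_expand.
  by move=> b p /negbTE /= ->.
rewrite exchange_big; apply: eq_bigr => b _.
pose y a := [eta x with i |-> w b, j |-> bas a].
have -> : tens [eta x with i |-> w b, j |-> w b] =
    \sum_a f (dual_bas f a) (w b) *: tens (y a).
  apply: (@tens_slot _ _ _ _ j) => /=.
    by rewrite jni eqxx -[LHS](sum_dual_bas nd).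
  by move=> a p /negbTE pj /=; rewrite pj.
rewrite scaler_sumr; apply: eq_bigr => a _.
by rewrite scalerA mulrC.
Qed.

(** [d] is [e_diag i j] times [d']. The generator contracts the places [i], [j] and inserts omega;
    of the sum over [b] only the colour of [p] survives, and its factor [g b] cancels the inverse in
    omega. *)
Lemma evaluates_contract d p q : d (inl i) = inl j -> d (inr p) = inr q ->
  evaluates (conj_diag (tperm (inl j) (inr p)) d) -> evaluates d.
Proof.
move=> dij dpq; set d' := conj_diag _ _ => ed m.
have dji : d (inl j) = inl i by rewrite -dij diagramK.
have dqp : d (inr q) = inr p by rewrite -dpq diagramK.
(* The colouring seen by [d'] for the summand [b] of omega. *)
pose mb b : vert r -> 'I_n := [eta m with inl i |-> b, inl j |-> b].
have E : amp (bd d) m =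
    f (w (m (inl i))) (w (m (inl j))) * \sum_b (g b)^-1 * amp (bd d') (mb b).
  rewrite {1}/amp; have -> : bd d = bmul (bd (e_diag i j)) (bd d').
    by rewrite bmul_bdiag (loops_e_diag dij dpq) (comp_e_diag dij dpq) expr0 scale1r.
  rewrite bpsiM rappM bpsi_e // sum_dual_tens [rapp _ _]linearZ /= pairZ.
  rewrite linear_sum pair_sum; congr (_ * _); apply: eq_bigr => b _.
  rewrite linearZ /= pairZ /amp; congr (_ * pair _ _ _).
  congr (rapp _ _); apply: eq_tens => x /=.
  by rewrite /mb /= !(inj_eq inl_inj); case: (x == i); case: (x == j).
rewrite E; case: (eqVneq (m (inl i)) (m (inl j))) => [mij|nm]; last first.
  rewrite w_orth // mul0r; case: (boolP (colors _ _)) => [/forallP|]; last by rewrite mul0r.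
  by move=> /(_ (inl i)); rewrite dij eq_sym (negbTE nm).
have mbi b : mb b (inl i) = b by rewrite /mb /= eqxx.
have mbj b : mb b (inl j) = b by rewrite /mb /= eqxx; case: ifP.
have mbr b x : mb b (inr x) = m (inr x) by [].
have mbo b u : u \notin [:: inl i; inl j; inr p; inr q] -> mb b u = m u.
  by rewrite !inE !negb_or => /and4P[/negbTE ui /negbTE uj _ _]; rewrite /mb /= ui uj.
have col b : colors d' (mb b) = (b == m (inr p)) && colors d m.
  apply/forallP/andP => [h|[/eqP -> /forallP h] u].
    have hp : b = m (inr p).
      by have := h (inr p); rewrite (conj_edge_p _ dij) mbi mbr => /eqP.
    have hq : b = m (inr q).
      by have := h (inr q); rewrite (conj_edge_q _ dpq) mbj mbr => /eqP.
    split; first by rewrite hp.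
    apply/forallP => u; case: (boolP (u \in [:: inl i; inl j; inr p; inr q])).
      by rewrite !inE => /or4P[] /eqP ->; rewrite ?dij ?dji ?dpq ?dqp -?hp -?hq ?mij.
    move=> nu; have := h u; rewrite (conj_edge dij dpq nu).
    by rewrite !mbo // (notin_edges dij dpq nu).
  case: (boolP (u \in [:: inl i; inl j; inr p; inr q])).
    rewrite !inE => /or4P[] /eqP ->.
    + by rewrite (conj_edge_i _ dij) mbi mbr.
    + by rewrite (conj_edge_j _ dpq) mbj mbr -dpq h.
    + by rewrite (conj_edge_p _ dij) mbi mbr.
    by rewrite (conj_edge_q _ dpq) mbj mbr -dpq eq_sym h.
  move=> nu; rewrite (conj_edge dij dpq nu) mbo.
    by rewrite mbo // h.
  exact: (notin_edges dij dpq nu).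
set wt0 := \prod_a g a ^+ #|[pred u | [&& u != inl i, u != inl j & m u == a]]|./2.
have wmb b : weight g (mb b) = g b * wt0.
  rewrite (weight_pair _ neqij) mbi ?mbj //.
  congr (_ * _); apply: eq_bigr => a _; congr (_ ^+ _./2); apply: eq_card => u.
  by rewrite !inE /mb /=; case: eqP => //; case: eqP.
rewrite (weight_pair _ neqij mij) -/wt0 -mij -/(g _) [RHS]mulrCA; congr (_ * _).
rewrite (bigD1 (m (inr p))) //= big1 => [|b bp]; last first.
  by rewrite ed col (negbTE bp) mul0r mulr0.
by rewrite addr0 ed col eqxx /= wmb mulrCA mulKf ?w_neq0.
Qed.

End Adjacent.

(** A transposition at distance [k.+2] is one at distance [k.+1] conjugated by an adjacent one. *)
Lemma evaluates_tperm_lt k (i j : 'I_r) d : j = (i + k.+1)%N :> nat ->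
  evaluates d -> evaluates (conj_diag (tperm (inl i) (inl j)) d).
Proof.
elim: k j d => [|k IH] j d jk ed.
  by apply: evaluates_adjacent => //; rewrite jk addn1.
have lr : (i + k.+1 < r)%N by have := ltn_ord j; lia.
pose l := Ordinal lr; pose t : {perm vert r} := tperm (inl l) (inl j).
have jl : j = l.+1 :> nat by rewrite jk /= addnS.
have -> : tperm (inl i) (inl j) = tperm (t (inl i)) (t (inl l)).
  rewrite /t tpermL tpermD // (inj_eq inl_inj) -val_eqE /=; lia.
rewrite -[d](conj_tpermK (inl l) (inl j)) -conj_diag_tpermJ.
apply: evaluates_adjacent => //; apply: IH => //.
exact: evaluates_adjacent.
Qed.

Lemma evaluates_tperm (i j : 'I_r) d :
  evaluates d -> evaluates (conj_diag (tperm (inl i) (inl j)) d).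
Proof.
case: (ltngtP i j) => [lt|lt|/ord_inj ->].
- by apply: (@evaluates_tperm_lt (j - i).-1); lia.
- by rewrite tpermC; apply: (@evaluates_tperm_lt (i - j).-1); lia.
have -> : conj_diag (tperm (inl j) (inl j)) d = d; last by [].
by rewrite tperm1; apply/diagramP => u; rewrite conj_diagE invg1 !perm1.
Qed.

(** Conjugation moves the end [j] next to [i], where the contraction of adjacent places applies. *)
Lemma evaluates_contract_lt (i j p q : 'I_r) d : (i < j)%N ->
    d (inl i) = inl j -> d (inr p) = inr q ->
  evaluates (conj_diag (tperm (inl j) (inr p)) d) -> evaluates d.
Proof.
move=> lt dij dpq ed; have kr : (i.+1 < r)%N by have := ltn_ord j; lia.
pose k := Ordinal kr; pose t : {perm vert r} := tperm (inl k) (inl j).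
have ti : t (inl i) = inl i.
  by rewrite tpermD // (inj_eq inl_inj) -val_eqE /=; lia.
have tV u : (t^-1)%g u = t u by rewrite tpermV.
have tr x : t (inr x) = inr x by rewrite tpermD.
rewrite -[d](conj_tpermK (inl k) (inl j)); apply: evaluates_tperm.
apply: (@evaluates_contract i k _ _ p q) => //.
- by rewrite conj_diagE -/t tV ti dij tpermR.
- by rewrite conj_diagE -/t tV tr dpq tr.
have -> : tperm (inl k) (inr p) = tperm (t (inl j)) (t (inr p)) by rewrite tr tpermR.
by rewrite -conj_diag_tpermJ; exact: evaluates_tperm.
Qed.

Definition is_top (u : vert r) := if u is inl _ then true else false.

(** Induction on the number of strands that are not vertical: exchanging the top points [p] and [q]
    straightens the strand ending at [q]. *)
Lemma evaluates_perm d : (forall p, ~~ is_top (d (inl p))) -> evaluates d.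
Proof.
have [k] := ubnP #|[set p | d (inl p) != inr p]|; elim: k d => // k IH d dk nt.
have [/existsP[p dp]|] := boolP [exists p, d (inl p) != inr p]; last first.
  rewrite negb_exists => /forallP h.
  have e p : d (inl p) = inr p by have /negbNE/eqP := h p.
  have -> : d = id_diag r; last exact: evaluates_id.
  by apply/diagramP => -[p|p]; rewrite ffunE //= -e diagramK.
have [q dq] : exists q, d (inl p) = inr q.
  by have := nt p; case: (d (inl p)) => // q _; exists q.
have qp : q != p by rewrite dq (inj_eq inr_inj) in dp.
rewrite -[d](conj_tpermK (inl p) (inl q)); apply: evaluates_tperm.
set t := tperm _ _; have tr x : t (inr x) = inr x by rewrite tpermD.
have dE x : conj_diag t d (inl x) = d (inl (tperm p q x)).
  rewrite conj_diagE tpermV -(inj_tperm _ _ _ inl_inj) -/t.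
  by have := nt (tperm p q x); case: (d _) => // y _; rewrite tr.
apply: IH => [|x]; last by rewrite dE.
apply: leq_trans (_ : #|[set x | d (inl x) != inr x]| <= k)%N => //.
apply: proper_card; apply/properP; split.
  apply/subsetP => x; rewrite !inE dE; case: tpermP => [->|->|] //.
  by rewrite dq eqxx.
exists q; last by rewrite inE dE tpermR dq eqxx.
rewrite inE; apply: contra qp => /eqP; rewrite -dq => /(congr1 d).
by rewrite !diagramK => -[->].
Qed.

(** Otherwise all bottom points have top partners; this injection is onto, leaving no top point for
    the edge ij. *)
Lemma has_bottom_edge d i j : d (inl i) = inl j -> exists p q, d (inr p) = inr q.
Proof.
move=> dij; apply: contrapT => h.
pose u p := if d (inr p) is inl q then q else p.
have uE p : d (inr p) = inl (u p).
  by rewrite /u; case E: (d (inr p)) => [//|q]; case: h; exists p, q.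
have u_inj : injective u.
  move=> x y exy; suff [//] : inr x = inr y :> vert r.
  by rewrite -[LHS](diagramK d) -[RHS](diagramK d) !uE exy.
by have := congr1 d (uE (invF u_inj i)); rewrite diagramK f_invF dij.
Qed.

(** Induction on the number of top points with a top partner: trading a top and a bottom edge for
    two through strands lowers it. *)
Theorem evaluates_all d : evaluates d.
Proof.
have [k] := ubnP #|[set p | is_top (d (inl p))]|; elim: k d => // k IH d dk.
have [/existsP[i0 ti0]|] := boolP [exists p, is_top (d (inl p))]; last first.
  by rewrite negb_exists => /forallP; exact: evaluates_perm.
have [i [j [lt dij]]] : exists i j : 'I_r, (i < j)%N /\ d (inl i) = inl j.
  case E: (d (inl i0)) ti0 => [j0|//] _.
  case: (ltngtP i0 j0) => [lt|lt|/ord_inj e]; first by exists i0, j0.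
    by exists j0, i0; split; rewrite // -E diagramK.
  by have := diagram_neq d (inl i0); rewrite E e eqxx.
have [p [q dpq]] := has_bottom_edge dij.
apply: (evaluates_contract_lt lt dij dpq); apply: IH.
apply: leq_trans (_ : #|[set x | is_top (d (inl x))]| <= k)%N => //.
apply: proper_card; apply/properP; split; last first.
  by exists i; rewrite inE ?dij // (conj_edge_i _ dij).
apply/subsetP => x; rewrite !inE.
case: (boolP (inl x \in [:: inl i; inl j; inr p; inr q])) => [|nx].
  rewrite !inE !orbF => /orP[] /eqP [->]; first by rewrite dij.
  by rewrite -dij diagramK.
by rewrite (conj_edge dij dpq nx).
Qed.

Lemma amp_sum (z : brauer r (n%:R : F)) m :
  amp z m = (\sum_(d | colors d m) z d) * weight g m.
Proof.
rewrite {1}[z]brauer_sum /amp linear_sum /rapp sum_lfunE pair_sum.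
rewrite mulr_suml [RHS]big_mkcond; apply: eq_bigr => d _.
rewrite linearZ /= scale_lfunE pairZ.
have := evaluates_all d m; rewrite /amp => ->.
by case: ifP => _; rewrite ?mul1r // mul0r mulr0.
Qed.

Lemma weight_neq0 m : weight g m != 0.
Proof. by apply/prodf_neq0 => a _; rewrite expf_neq0 ?w_neq0. Qed.

Lemma Psi_eq0P (z : brauer r (n%:R : F)) : Psi z = 0 <-> color_null n z.
Proof.
split=> [z0 m|nz].
  apply: (mulIf (weight_neq0 m)); rewrite mul0r -amp_sum /amp z0.
  by rewrite /rapp zero_lfunE pair0.
(* Expanding both arguments in the orthogonal basis leaves only the coefficients [amp], which vanish
   by hypothesis. *)
have amp0 (x : 'I_r -> V) y : pair f (rapp (tens x) (Psi z)) y = 0.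
  rewrite (@tens_expand _ _ _ _ w x (fun p a => f (x p) (w a) / g a)); last first.
    by move=> p; exact: orthogonal_expand.
  rewrite /rapp linear_sum pair_sum big1 // => k _; rewrite linearZ /= pairZ.
  rewrite (@pair_expand _ _ _ _ _ w _ y (fun p a => f (y p) (w a) / g a)); last first.
    by move=> p; exact: orthogonal_expand.
  rewrite [X in _ * X]big1 ?mulr0 // => l _.
  pose m u := match u with inl p => k p | inr p => l p end.
  have := amp_sum z m; rewrite nz mul0r /amp /rapp => h.
  by rewrite [pair _ _ _]h mulr0.
apply/lfunP => t; rewrite zero_lfunE [t]tpow_expand linear_sum big1 // => k _.
rewrite linearZ /= (_ : Psi z _ = 0) ?scaler0 //; apply/ffunP => l.
by rewrite -(pair_dual_bas nd) [LHS]amp0 ffunE.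
Qed.

End Evaluation.

Theorem brauer_hom_eq0P (F : fieldType) (V : vectType F) (f : {symmetric V}) (r : nat)
    (Psi : brauer_hom f r) (z : brauer r ((\dim {:V})%:R : F)) :
  2%N \notin [pchar F] -> nondegenerate f ->
  Psi z = 0 <-> color_null (\dim {:V}) z.
Proof.
move=> char2 nd; have [w [w1 w2 w3]] := orthogonal_basis char2 nd.
exact: (Psi_eq0P Psi nd w1 w2 w3).
Qed.

(** * Specialization *)

Section TensorPure.
Variables (A : pzRingType) (K : comNzRingType).
Implicit Types (a b : A) (x y : K).

Lemma pureDl a b x : pure (a + b) x = pure a x + pure b x.
Proof. by rewrite [RHS]sumtD; apply/sumt_eq/tens_addl. Qed.

Lemma pureDr a x y : pure a (x + y) = pure a x + pure a y.
Proof. by rewrite [RHS]sumtD; apply/sumt_eq/tens_addr. Qed.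

Lemma pure0l x : pure (0 : A) x = 0.
Proof. exact/sumt_eq/tens_zero. Qed.

Lemma pure0r a : pure a (0 : K) = 0.
Proof. by apply: (addrI (pure a 0)); rewrite -pureDr !addr0. Qed.

Lemma pureNl a x : pure (- a) x = - pure a x.
Proof. by apply: (addrI (pure a x)); rewrite -pureDl !subrr pure0l. Qed.

Lemma pureNr a x : pure a (- x) = - pure a x.
Proof. by apply: (addrI (pure a x)); rewrite -pureDr !subrr pure0r. Qed.

Lemma pureMn a x n : pure (a *+ n) x = pure a (x *+ n).
Proof. by elim: n => [|n IH]; rewrite ?pure0l ?pure0r // !mulrS pureDl IH pureDr. Qed.

Lemma pureMz a x (n : int) : pure (a *~ n) x = pure a (x *~ n).
Proof. by case: n => n; rewrite ?NegzE ?mulrNz ?pureNl ?pureNr pureMn. Qed.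

Lemma pureM a b x y : pure a x * pure b y = pure (a * b) (x * y).
Proof. exact: sumtM. Qed.

Lemma pureZ c a x : c *: pure a x = pure a (c * x).
Proof. exact: sumtZ. Qed.

Lemma pure_suml I (s : seq I) (P : pred I) (G : I -> A) x :
  pure (\sum_(i <- s | P i) G i) x = \sum_(i <- s | P i) pure (G i) x.
Proof. by elim/big_rec2: _ => [|i u v _ <-]; rewrite ?pure0l ?pureDl. Qed.

Lemma sumtE (s : seq (A * K)) : sumt s = \sum_(w <- s) pure w.1 w.2.
Proof.
elim: s => [|[a x] s IH]; first by rewrite big_nil.
by rewrite big_cons -IH [RHS]sumtD.
Qed.

(** The universal property of the tensor product, in the form that a biadditive map respects every
    relation between pure tensors. *)
Lemma tensorZ_balanced (W : zmodType) (h : A -> K -> W) I (s : seq I)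
    (G : I -> A) (c : I -> K) :
    (forall x, {morph h^~ x : a b / a + b}) -> (forall a, {morph h a : x y / x + y}) ->
  \sum_(i <- s) pure (G i) (c i) = 0 -> \sum_(i <- s) h (G i) (c i) = 0.
Proof.
move=> hDl hDr; pose ev (t : seq (A * K)) := \sum_(w <- t) h w.1 w.2.
have h0 x : h 0 x = 0 by apply: (addrI (h 0 x)); rewrite -hDl !addr0.
have ev_eq t u : tens_eq t u -> ev t = ev u.
  rewrite /ev; elim=> {t u} //.
  - by move=> t u v _ -> _ ->.
  - by move=> t t' u u' _ e _ e'; rewrite !big_cat /= e e'.
  - by move=> t u; rewrite !big_cat /= addrC.
  - by move=> x; rewrite big_seq1 big_nil h0.
  - by move=> a b x; rewrite !big_cons !big_nil /= !addr0 hDl.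
  by move=> a x y; rewrite !big_cons !big_nil /= !addr0 hDr.
have -> : \sum_(i <- s) pure (G i) (c i) = sumt [seq (G i, c i) | i <- s].
  by rewrite sumtE big_map.
move=> e; have /ev_eq : tens_eq [seq (G i, c i) | i <- s] [::].
  by apply/sumtP/eqP.
by rewrite /ev big_map big_nil.
Qed.

End TensorPure.

Section Descent.
Variables (F : fieldType) (V : vectType F) (f : {symmetric V}) (r : nat).
Variables (Psi : brauer_hom f r) (W : lmodType F).
Variable Th : brauer r ((\dim {:V})%:R : F) -> W.
Hypotheses (Th_lin : linear Th) (Th_ker : forall x, Th x = 0 <-> Psi x = 0).
Hypothesis Th_surj : forall u, exists x, Th x = u.

Lemma bca_lift (g : bca Psi) : exists x, Psi x = bca_val g.
Proof. by case: g => g /= /asboolP. Qed.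

(** The first isomorphism theorem: [Th] and [Psi] have the same kernel. The clause relating [phi] to
    [Th] serves to transfer products. *)
Lemma bca_descent : exists phi : {linear bca Psi -> W},
  bijective phi /\ forall g x, Psi x = bca_val g -> phi g = Th x.
Proof.
have [lift liftE] := choice bca_lift.
have ThE x y : Psi x = Psi y -> Th x = Th y.
  move=> e; apply/eqP; rewrite -subr_eq0; apply/eqP.
  have -> : Th x - Th y = Th (x - y).
    by rewrite addrC -scaleN1r -Th_lin scaleN1r addrC.
  by apply/Th_ker; rewrite linearB e subrr.
have phi_lin : linear (Th \o lift).
  move=> c g h /=; rewrite -Th_lin; apply: ThE.
  by rewrite linearP !liftE.
pose L := GRing.isLinear.Build F _ _ _ _ phi_lin.
pose phi : {linear bca Psi -> W} := HB.pack (Th \o lift) L.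
have phiE (g : bca Psi) x : Psi x = bca_val g -> phi g = Th x.
  by move=> e; apply: ThE; rewrite liftE.
exists phi; split=> //; have [pre preE] := choice Th_surj.
have im x : Psi x \in bca_pred Psi by apply/asboolP; exists x.
exists (fun u => Bca (im (pre u))) => [g|u].
  apply: val_inj; rewrite /= -(liftE g); apply/eqP; rewrite -subr_eq0 -linearB.
  apply/eqP/Th_ker; have -> : pre (phi g) - lift g = - 1 *: lift g + pre (phi g).
    by rewrite scaleN1r addrC.
  by rewrite Th_lin preE scaleN1r addNr.
by rewrite (phiE _ (pre u)).
Qed.

End Descent.

Lemma std_form_nondegenerate (F : fieldType) (N : nat) : 
  nondegenerate (std_form F N : {symmetric 'rV[F]_N}).
Proof.
rewrite /nondegenerate -subv0; apply/subvP => x /mem_orthovP x0.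
rewrite memv0; apply/eqP/rowP => i; rewrite mxE.
have := x0 (delta_mx 0 (rev_ord i)) (memvf _).
rewrite /= /std_form (bigD1 i) //= mxE !eqxx mulr1 big1 ?addr0 // => j ji.
by rewrite mxE (inj_eq rev_ord_inj) (negbTE ji) andbF mulr0.
Qed.

(** * Extension of scalars from the integral algebra *)

Section Specialization.
Variables (C : fieldType) (VC : vectType C) (fC : {symmetric VC}) (r : nat).
Variable PsiC : brauer_hom fC r.
Local Notation D := (\dim {:VC}).
Local Notation brauerZ := (brauer r (D%:R : int)).
Hypothesis kerC : forall z : brauerZ, PsiC (bmap C z) = 0 <-> color_null D z.

Lemma imZ_subproof (z : brauerZ) : PsiC (bmap C z) \in bcaZ_pred PsiC.
Proof. by apply/asboolP; exists z. Qed.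

Definition imZ z : bcaZ PsiC := BcaZ (imZ_subproof z).

Lemma imZ_is_additive : zmod_morphism imZ.
Proof. by move=> x y; apply: val_inj; rewrite /= bmapB linearB. Qed.

HB.instance Definition _ := GRing.isZmodMorphism.Build _ _ imZ imZ_is_additive.

Lemma imZM x y : imZ (bmul x y) = imZ x * imZ y.
Proof. by apply: val_inj; rewrite /= bmapM bpsiM. Qed.

Lemma imZ1 : imZ (bone r _) = 1.
Proof. by apply: val_inj; rewrite /= bmap1 bpsi1. Qed.

Lemma imZ_eq0 x : imZ x = 0 <-> color_null D x.
Proof. by rewrite -kerC; split=> [/(congr1 val)|e]; [|apply: val_inj]. Qed.

Lemma imZ_surj a : exists z, imZ z = a.
Proof. by case: a => a aP; have /asboolP[z e] := aP; exists z; apply: val_inj. Qed.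

Local Notation bz := (bdiag (D%:R : int)).

Lemma imZ_sum z : imZ z = \sum_d imZ (bz d) *~ z d.
Proof.
rewrite {1}[z]brauer_sum raddf_sum; apply: eq_bigr => d _.
by rewrite -raddfMz -scaler_int intz.
Qed.

Section Scalars.
Variables (k : comNzRingType) (delta : k).
Hypothesis deltaE : delta = D%:R.

(** The scalar extension of [imZ]. The parameter [delta] is only propositionally equal to the
    dimension of [VC], because it will come from another space. *)
Definition spec (x : brauer r delta) : tensorZ (bcaZ PsiC) k :=
  \sum_d @pure _ k (imZ (bz d)) (x d).

Lemma spec_linear : linear spec.
Proof.
move=> c x y; rewrite /spec scaler_sumr -big_split; apply: eq_bigr => d _ /=.
by rewrite !ffunE pureDr pureZ.
Qed.

HB.instance Definition _ := GRing.isLinear.Build k _ _ _ spec spec_linear.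

Lemma spec_bdiag d : spec (bdiag delta d) = pure (imZ (bz d)) 1.
Proof.
rewrite /spec (bigD1 d) //= ffunE eqxx big1 ?addr0 // => e ed.
by rewrite ffunE (negbTE ed) pure0r.
Qed.

Lemma spec1 : spec (bone r delta) = 1.
Proof. by rewrite spec_bdiag imZ1. Qed.

Lemma specM : {morph spec : x y / bmul x y >-> x * y}.
Proof.
move=> x y; rewrite [in RHS]/spec mulr_suml /bmul linear_sum.
apply: eq_bigr => a _; rewrite mulr_sumr linear_sum; apply: eq_bigr => b _.
rewrite linearZ /= spec_bdiag pureZ mulr1 pureM -imZM bmul_bdiag.
rewrite deltaE -!natrX scaler_nat raddfMn pureMn mulr_natr //.
Qed.

Lemma pure_imZ z (c : k) : pure (imZ z) c = spec [ffun d => (z d)%:~R * c].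
Proof.
rewrite imZ_sum pure_suml; apply: eq_bigr => d _.
by rewrite ffunE pureMz mulrzl.
Qed.

Lemma spec_surj u : exists x, spec x = u.
Proof.
elim/sumtW: u => s; rewrite sumtE; elim/big_ind: _ => [|u v [x <-] [y <-]|w _].
- by exists 0; rewrite linear0.
- by exists (x + y); rewrite linearD.
by have [z <-] := imZ_surj w.1; eexists; rewrite pure_imZ.
Qed.

(** For each colouring, the sum of the coefficients of monochromatic diagrams is a functional on the
    integral algebra, since it kills L over the integers; its scalar extension detects the sum for
    [x]. *)
Lemma spec_color_null x : spec x = 0 -> color_null D x.
Proof.
move=> sx m; pose lam (a : bcaZ PsiC) := \sum_(d | colors d m) projT1 (cid (imZ_surj a)) d.
have lamE z : lam (imZ z) = \sum_(d | colors d m) z d.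
  rewrite /lam; case: cid => z' /= e; apply/eqP; rewrite -subr_eq0 -sumrB.
  have /imZ_eq0 /(_ m) h : imZ (z' - z) = 0 by rewrite raddfB /= e subrr.
  by apply/eqP; rewrite -[RHS]h; apply: eq_bigr => d _; rewrite !ffunE.
have lamD a b : lam (a + b) = lam a + lam b.
  have [z <-] := imZ_surj a; have [z' <-] := imZ_surj b.
  rewrite -raddfD !lamE -big_split; apply: eq_bigr => d _.
  by rewrite !ffunE.
have := @tensorZ_balanced _ _ _ (fun a c => (lam a)%:~R * c) _ _ _ _ _ _ sx.
move=> h; rewrite -[RHS]h => [|c a b|a c e].
- rewrite big_mkcond /=; apply: eq_bigr => d _; rewrite lamE.
  rewrite big_mkcond (bigD1 d) //= ffunE eqxx big1 => [|e ed]; last first.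
    by rewrite ffunE (negbTE ed) if_same.
  by rewrite addr0; case: ifP => _; rewrite ?mul1r ?mul0r.
- by rewrite lamD rmorphD mulrDl.
by rewrite mulrDr.
Qed.

(** Straightening each diagram over the integers replaces [x] by a good [y] with the same image.
    Here [x - y] is a combination of specialized integral elements of L, so [y] is good and lies in
    L, hence is 0. *)
Lemma color_null_spec x : color_null D x -> spec x = 0.
Proof.
move=> nx.
have /choice [v vE] : forall d, exists v : brauerZ,
    (forall e, ~~ good D e -> v e = 0) /\ color_null D (bz d - v).
  by move=> d; exact: straight_bdiag.
have imE d : imZ (bz d) = imZ (v d).
  have [_ /imZ_eq0] := vE d; rewrite raddfB => /eqP.
  by rewrite subr_eq0 => /eqP.
pose y : brauer r delta := \sum_d [ffun e => (v d e)%:~R * x d].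
have -> : spec x = spec y.
  rewrite /y linear_sum; apply: eq_bigr => d _.
  by rewrite imE pure_imZ.
suff -> : y = 0 by rewrite linear0.
apply: (@color_null_good r D _ y).
  move=> e be; rewrite [LHS]sum_ffunE big1 // => d _; rewrite ffunE.
  by have [-> //] := vE d; rewrite mul0r.
have -> : y = x - (x - y) by rewrite subKr.
apply: color_nullD => //; apply: color_nullN => m.
have xE : x - y = \sum_d [ffun e => (bz d e - v d e)%:~R * x d].
  rewrite {1}(@brauer_sum _ _ delta x) -sumrB; apply: eq_bigr => d _; apply/ffunP => e.
  rewrite !ffunE rmorphB mulrBl /= rmorph_nat; congr (_ - _).
  by rewrite mulrC.
rewrite xE (eq_bigr (fun e => \sum_d (bz d e - v d e)%:~R * x d)); last first.
  by move=> e _; rewrite [LHS]sum_ffunE; apply: eq_bigr => d _; rewrite ffunE.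
rewrite exchange_big big1 // => d _; rewrite -mulr_suml -rmorph_sum /=.
have [_ /(_ m) h] := vE d.
rewrite (eq_bigr (fun e => (bz d - v d) e)); last by move=> e _; rewrite !ffunE.
by rewrite h mul0r.
Qed.

Lemma spec_eq0 x : spec x = 0 <-> color_null D x.
Proof. by split; [exact: spec_color_null | exact: color_null_spec]. Qed.

End Scalars.

End Specialization.

Lemma color_null_bmap (C : numDomainType) r N D (z : brauer r (N%:R : int)) :
  color_null D (bmap C z) <-> color_null D z.
Proof.
have E m : \sum_(d | colors d m) bmap C z d = (\sum_(d | colors d m) z d)%:~R.
  by rewrite rmorph_sum; apply: eq_bigr => d _; rewrite ffunE.
split=> h m; last by rewrite E h.
by apply/eqP; rewrite -(intr_eq0 C) -E h.
Qed.

Local Open Scope complex_scope.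

Theorem corollary8p17 (R : realType) (k : fieldType)
    (char_k : 2%N \notin [pchar k]) (V : vectType k) (N r : nat)
    (dimV : \dim {:V} = N) (r_gt0 : (0 < r)%N)
    (PsiC : brauer_hom (std_form R[i] N) r) :
  (forall (f : {symmetric V}) (Psi : brauer_hom f r), nondegenerate f ->
     exists phi : {linear bca Psi -> tensorZ (bcaZ PsiC) k},
       monoid_morphism phi /\ bijective phi) /\
  (forall (f1 f2 : {symmetric V})
     (Psi1 : brauer_hom f1 r) (Psi2 : brauer_hom f2 r),
     nondegenerate f1 -> nondegenerate f2 ->
     exists phi : {linear bca Psi1 -> bca Psi2},
       monoid_morphism phi /\ bijective phi).
Proof.
have dimC : \dim {:'rV[R[i]]_N} = \dim {:V} by rewrite dimvf /dim /= mul1n dimV.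
have charC : 2%N \notin [pchar R[i]] by rewrite Num.Theory.pchar_num.
have kerC z : PsiC (bmap R[i] z) = 0 <-> color_null (\dim {:'rV[R[i]]_N}) z.
  rewrite -(color_null_bmap R[i]).
  exact: brauer_hom_eq0P charC (std_form_nondegenerate _ _).
split=> [f Psi nd|f1 f2 Psi1 Psi2 nd1 nd2].
  have deltaE : (\dim {:V})%:R = (\dim {:'rV[R[i]]_N})%:R :> k by rewrite dimC.
  have ker x : spec PsiC x = 0 <-> Psi x = 0.
    by rewrite (spec_eq0 kerC) dimC (brauer_hom_eq0P Psi x char_k nd).
  have [phi [phi_bij phiE]] := bca_descent (@spec_linear _ _ _ _ PsiC _ _) ker (spec_surj _).
  exists phi; split=> //; split=> [|g h].
    by rewrite (phiE _ (bone r _)) ?bpsi1 // spec1.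
  have [x xE] := bca_lift g; have [y yE] := bca_lift h.
  rewrite (phiE g x xE) (phiE h y yE) -(specM _ deltaE); apply: phiE.
  by rewrite bpsiM xE yE.
(* Both kernels are L, whose definition involves no form, so [Psi2] itself descends to the image of
   [Psi1]. *)
have im x : Psi2 x \in bca_pred Psi2 by apply/asboolP; exists x.
pose Th x : bca Psi2 := Bca (im x).
have Th_lin : linear Th by move=> c x y; apply: val_inj; rewrite /= linearP.
have ker x : Th x = 0 <-> Psi1 x = 0.
  rewrite (brauer_hom_eq0P Psi1 x char_k nd1) -(brauer_hom_eq0P Psi2 x char_k nd2).
  by split=> [/(congr1 val)|e]; [|apply: val_inj].
have Th_surj u : exists x, Th x = u.
  by have [x xE] := bca_lift u; exists x; apply: val_inj.
have [phi [phi_bij phiE]] := bca_descent Th_lin ker Th_surj.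
exists phi; split=> //; split=> [|g h].
  by rewrite (phiE _ (bone r _)) ?bpsi1 //; apply: val_inj; rewrite /= bpsi1.
have [x xE] := bca_lift g; have [y yE] := bca_lift h.
rewrite (phiE g x xE) (phiE h y yE) (phiE _ (bmul x y)) ?bpsiM ?xE ?yE //.
by apply: val_inj; rewrite /= bpsiM.
Qed.
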